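(* Let $\mathcal{H}$ be a Krein space, $W\in L(\mathcal{H})^{[s]}$ and let $\mathcal{S}$ be a regular subspace of $\mathcal{H}$. Write $$W=\begin{pmatrix} w_{11}&w_{12}\\ w_{12}^{\#}&w_{22}\end{pmatrix}$$ with respect to $\mathcal{H}=\mathcal{S}\,[\dotplus]\,\mathcal{S}^{[\perp]}$, and let $w_{11}=dd^{\#}$, $d\in L(\mathcal{K},\mathcal{S})$, be any polar factorization of $w_{11}$. Then $W$ is $\mathcal{S}$-weakly complementable if and only if $R(w_{12})\subseteq R(d)$. In this case, $$W_{/[\mathcal{S}]}=\begin{pmatrix}0&0\\0&w_{22}-y^{\#}y\end{pmatrix}$$ with respect to $\mathcal{S}\,[\dotplus]\,\mathcal{S}^{[\perp]}$, where $y\in L(\mathcal{S}^{[\perp]},\mathcal{K})$ is the only solution of the equation $w_{12}=dx$.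
   Context: Hilbert spaces are complex and separable. A Krein space $(\mathcal{H},[\,\cdot,\cdot\,])$ is a linear space with a sesquilinear Hermitian form admitting a fundamental decomposition $\mathcal{H}=\mathcal{H}_+[\dotplus]\mathcal{H}_-$, an $[\,\cdot,\cdot\,]$-orthogonal direct sum in which $(\mathcal{H}_+,[\,\cdot,\cdot\,])$ and $(\mathcal{H}_-,-[\,\cdot,\cdot\,])$ are Hilbert spaces. The associated signature operator is $J=P_+-P_-$, where $P_\pm$ is the projection onto $\mathcal{H}_\pm$ with nullspace $\mathcal{H}_\mp$; it yields the Hilbert space inner product $\langle x,y\rangle=[Jx,y]$. All Hilbert norms arising this way are equivalent; $L(\mathcal{H},\mathcal{K})$ is the set of operators between Krein spaces bounded for such norms, $L(\mathcal H)=L(\mathcal H,\mathcal H)$. $T^{\#}$ denotes the Krein space adjoint (with respect to the indefinite metrics), and $L(\mathcal{H})^{[s]}=\{T\in L(\mathcal{H}):T=T^{\#}\}$. $\mathcal{S}^{[\perp]}=\{x:[x,s]=0\ \forall s\in\mathcal{S}\}$. A closed subspace $\mathcal{S}$ is regular if it is a Krein space in the metric of $\mathcal{H}$, equivalently $\mathcal{H}=\mathcal{S}\,[\dotplus]\,\mathcal{S}^{[\perp]}$ (orthogonal direct sum). $R(\cdot)$, $N(\cdot)$ denote range and nullspace. Polar factorization: let $V$ be a bounded selfadjoint operator on a Krein space $\mathcal{G}$ (here $\mathcal{G}=\mathcal{S}$, $V=w_{11}$), and let $J$ be a signature operator of $\mathcal{G}$. In the Hilbert space associated with $J$, $JV$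 is selfadjoint; let $JV=U|JV|=|JV|U$ be its polar decomposition ($N(U)=N(JV)$). Then $\mathcal{K}:=\overline{R(|JV|)}$ is a Krein space with signature operator $J_{\mathcal{K}}:=U|_{\mathcal{K}}$ (i.e. with indefinite metric $[k,k']_{\mathcal{K}}=\langle Uk,k'\rangle$). Define $D\in L(\mathcal{K},\mathcal{G})$ by $Dk:=J|JV|^{1/2}k$. Then $N(D)=\{0\}$ and $V=DD^{\#}$. A factorization obtained in this way (for some signature operator $J$ of $\mathcal{G}$) is called a polar factorization of $V$. Hilbert space notions: let $B$ be a bounded selfadjoint operator on a Hilbert space with block form $B=\begin{pmatrix} a & b\\ b^* & c\end{pmatrix}$ with respect to $\mathcal{S}\oplus\mathcal{S}^\perp$. $B$ is $\mathcal{S}$-weakly complementable if $R(b)\subseteq R(|a|^{1/2})$. In that case let $f$ be the reduced solution of $b=|a|^{1/2}x$, i.e. the unique bounded $f:\mathcal{S}^\perp\to\mathcal{S}$ with $b=|a|^{1/2}f$, $N(f)=N(b)$, $R(f)\subseteq\overline{R(|a|^{1/2})}$, and let $a=u|a|$ be the polar decomposition ($N(u)=N(a)$). The Schur complement is $B_{/\mathcal{S}}:=\begin{pmatrix}0&0\\0&c-f^*uf\end{pmatrix}$. Krein space notions: $W$ is $\mathcal{S}$-weakly complementable if $JW$ is $\mathcal{S}$-weakly complementable in the Hilbert space associated with some signature operator $J$ of $\mathcal{H}$, and then $W_{/[\mathcal{S}]}:=J\,(JW)_{/\mathcal{S}}$; neither notion depends on the choice of $J$. *)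

(* Defs.v *)
(* A Krein space is an [lmodType R[i]] carrying a Hermitian form, linear in its
   first argument, that admits a fundamental decomposition.  It has no preferred
   norm: each signature operator [J] gives an inner product [ip J], and
   [ip_space g] is the normed module whose norm comes from the inner product
   [g].  The Hilbert space operators |T|, |T|^(1/2), adjoints, polar and block
   decompositions are specified by predicates, each of which determines its
   operator uniquely.                                                          *)
From HB Require Import structures.
From mathcomp Require Import all_boot all_order all_algebra.
From mathcomp Require Import sesquilinear complex ring.
From mathcomp Require Import all_classical all_reals all_analysis.

Set Implicit Arguments.
Unset Strict Implicit.
Unset Printing Implicit Defensive.

Import Order.TTheory GRing.Theory Num.Theory Num.Def.
Import numFieldNormedType.Exports.

Local Open Scope classical_set_scope.
Local Open Scope complex_scope.
Local Open Scope ring_scope.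

Notation hermitian_form V := {hermitian_sym V for conjC}.
Notation inner_product V := {dot V for conjC}.

Section Subspaces.
Context (C : nzRingType) (V : lmodType C).

Record lsubspace := Subspace {
  lsubspace_set : set V;
  lsubspaceP : submod_closed (mem lsubspace_set) }.

Definition lsubspace_pred (S : lsubspace) : {pred V} := mem (lsubspace_set S).

HB.instance Definition _ (S : lsubspace) :=
  GRing.isSubmodClosed.Build C V (lsubspace_pred S) (lsubspaceP S).

Record lsubspace_sort (S : lsubspace) := SubspaceElt {
  lsubspace_val : V;
  lsubspace_valP : lsubspace_val \in lsubspace_pred S }.

HB.instance Definition _ (S : lsubspace) :=
  [isSub of lsubspace_sort S for @lsubspace_val S].
HB.instance Definition _ (S : lsubspace) := [Choice of lsubspace_sort S by <:].
HB.instance Definition _ (S : lsubspace) :=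
  [SubChoice_isSubLmodule of lsubspace_sort S by <:].

End Subspaces.

Coercion lsubspace_sort : lsubspace >-> Sortclass.
Arguments lsubspace_set {C V} S : rename.

Section Forms.
Context (C : numClosedFieldType) (V : lmodType C).

Definition restr (g : V -> V -> C) (S : lsubspace V) (x y : S) : C :=
  g (val x) (val y).
Arguments restr g S x y : clear implicits.

Section Restriction.
Variables (g : hermitian_form V) (S : lsubspace V).

Fact restr_zmodl (y : S) : zmod_morphism ((restr g S)^~ y).
Proof. by move=> x x'; rewrite /restr raddfB /= linearBl. Qed.

Fact restr_zmodr (x : S) : zmod_morphism (restr g S x).
Proof. by move=> y y'; rewrite /restr !raddfB. Qed.

Fact restr_scalel (y : S) : scalable_for *%R ((restr g S)^~ y).
Proof. by move=> a x; rewrite /restr linearZ /= linearZl_LR. Qed.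

Fact restr_scaler (x : S) : scalable_for (conjC \; *%R) (restr g S x).
Proof. by move=> a y; rewrite /restr !linearZ. Qed.

HB.instance Definition _ := isBilinear.Build C S S C *%R (conjC \; *%R)
  (restr g S) restr_zmodl restr_zmodr restr_scalel restr_scaler.

Fact restr_hermitian (x y : S) :
  restr g S x y = (-1) ^+ false * conjC (restr g S y x).
Proof. exact: hermitian_subproof. Qed.

HB.instance Definition _ := isHermitianSesquilinear.Build C S false conjC
  (restr g S) restr_hermitian.

End Restriction.

HB.instance Definition _ (g : inner_product V) (S : lsubspace V) :=
  Hermitian.on (restr g S).

Fact restr_dnorm_gt0 (g : inner_product V) (S : lsubspace V) (x : S) :
  x != 0 -> 0 < restr g S x x.
Proof. move=> x0; apply: neq0_dnorm_gt0; apply: contraNneq x0 => x0.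
by apply/eqP/val_inj; rewrite x0 raddf0. Qed.

HB.instance Definition _ (g : inner_product V) (S : lsubspace V) :=
  isDotProduct.Build C S (restr g S) (@restr_dnorm_gt0 g S).
End Forms.

Arguments restr {C V} g S x y.

Section InnerProductSpace.
Context (C : numClosedFieldType) (V : lmodType C).

Definition ip_space (g : inner_product V) : Type := V.

HB.instance Definition _ (g : inner_product V) :=
  GRing.Lmodule.on (ip_space g).

Definition ip_norm (g : inner_product V) (x : ip_space g) : C :=
  sqrtC (g x x).

Variable g : inner_product V.

Fact ip_cauchy_schwarz (x y : V) :
  `|g x y| <= sqrtC (g x x) * sqrtC (g y y).
Proof.
have [->|y0] := eqVneq y 0.
  by rewrite linear0r normr0 mulr_ge0 ?sqrtC_ge0 ?dnorm_ge0.
have gy : 0 < g y y by rewrite neq0_dnorm_gt0.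
rewrite -(@ler_pXn2r _ 2) ?nnegrE ?mulr_ge0 ?sqrtC_ge0 ?dnorm_ge0//.
rewrite exprMn !sqrtCK -ler_pdivrMr// -subr_ge0.
have := dnorm_ge0 g (x - (g x y / g y y) *: y).
congr (0 <= _); rewrite dnormB dnormZ.
set a := g x y / g y y.
have aE : conjC a * g x y = `|g x y| ^+ 2 / g y y.
  by rewrite /a rmorphM fmorphV/= (geC0_conj (ltW gy)) normCK
    mulrAC [X in X / _ = _]mulrC.
have -> : g x (a *: y) = `|g x y| ^+ 2 / g y y.
  by rewrite linearZr_LR/=.
have -> : `|a| ^+ 2 * g y y = `|g x y| ^+ 2 / g y y.
  rewrite /a normf_div expr_div_n (ger0_norm (ltW gy)) expr2.
  by field; rewrite gt_eqF.
have /geC0_conj-> : 0 <= `|g x y| ^+ 2 / g y y.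
  by rewrite divr_ge0// ?exprn_ge0// ltW.
by rewrite opprD addrA addrK.
Qed.

Fact ip_norm_triangle (x y : ip_space g) :
  ip_norm (x + y) <= ip_norm x + ip_norm y.
Proof.
rewrite /ip_norm.
rewrite -(@ler_pXn2r _ 2) ?nnegrE ?addr_ge0 ?sqrtC_ge0 ?dnorm_ge0//.
rewrite sqrrD !sqrtCK dnormD addrAC lerD2r lerD2l -mulr_natr.
apply: le_trans (ler_wpM2r (ler0n _ 2) (ip_cauchy_schwarz x y)).
have -> : g x y + conjC (g x y) = 'Re (g x y) * 2.
  by rewrite ReE divfK ?pnatr_eq0.
by rewrite ler_wpM2r ?ler0n// leif_Re_Creal.
Qed.

Fact ip_normZ (a : C) (x : ip_space g) : ip_norm (a *: x) = `|a| * ip_norm x.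
Proof.
rewrite /ip_norm dnormZ sqrtCM ?nnegrE ?exprn_ge0 ?dnorm_ge0//.
by rewrite exprCK.
Qed.

Fact ip_norm_eq0 (x : ip_space g) : ip_norm x = 0 -> x = 0.
Proof. by move/eqP; rewrite sqrtC_eq0 dnorm_eq0 => /eqP. Qed.

HB.instance Definition _ := Lmodule_isNormed.Build C (ip_space g)
  ip_norm_triangle ip_normZ ip_norm_eq0.

End InnerProductSpace.

Section OrthogonalComplement.
Context (C : numClosedFieldType) (V : lmodType C).
Variables (f : hermitian_form V) (S : lsubspace V).

Definition orthocompl_set : set V :=
  [set x | forall s, lsubspace_set S s -> f x s = 0].

Fact orthocompl_submod_closed : submod_closed (mem orthocompl_set).
Proof.
split; first by apply/mem_set => s _; rewrite linear0l.
move=> a x y /set_mem xS /set_mem yS; apply/mem_set => s Ss.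
by rewrite linearPl /= xS// yS// mulr0 addr0.
Qed.

Definition orthocompl : lsubspace V := Subspace orthocompl_submod_closed.

End OrthogonalComplement.

Section Operators.
Context (C : numClosedFieldType).
Implicit Types U V : lmodType C.

(* [T'] is the adjoint of [T]; [adjoint_pair f f T T] says that [T] is
   selfadjoint.                                                                *)
Definition adjoint_pair U V (fU : U -> U -> C) (fV : V -> V -> C)
    (T : U -> V) (T' : V -> U) : Prop :=
  forall x y, fV (T x) y = fU x (T' y).

Definition direct_sum V (S T : lsubspace V) : Prop :=
  (forall x : V, exists (s : S) (t : T), x = val s + val t) /\
  lsubspace_set S `&` lsubspace_set T = [set 0].

(* X is the operator matrix with first row (a b) and second row (c d). *)
Definition block_form V (S T : lsubspace V) (X : V -> V)
    (a : S -> S) (b : T -> S) (c : S -> T) (d : T -> T) : Prop :=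
  (forall s : S, X (val s) = val (a s) + val (c s)) /\
  (forall t : T, X (val t) = val (b t) + val (d t)).

End Operators.

Section HilbertSpace.
Context (R : realType).
Implicit Types U V : lmodType R[i].

Definition hilbert_space V (h : V -> V -> R[i]) : Prop :=
  exists g : inner_product V,
    [/\ forall x y, h x y = g x y,
        forall F : set_system (ip_space g),
          ProperFilter F -> cauchy F -> cvg F
      & exists2 D : set (ip_space g), countable D & dense D].

Definition bounded_op U V (gU : inner_product U) (gV : inner_product V)
    (T : U -> V) : Prop :=
  exists M : R, forall x : U,
    `|T x : ip_space gV| <= M%:C * `|x : ip_space gU|.

(* Positivity includes selfadjointness, since the scalars are complex.         *)
Definition positive_sqrt V (g : inner_product V) (P Q : {linear V -> V}) :
    Prop :=
  [/\ bounded_op g g Q, forall x, 0 <= g (Q x) x & forall x, Q (Q x) = P x].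

Definition modulus V (g : inner_product V) (T A : {linear V -> V}) : Prop :=
  exists2 T' : {linear V -> V},
    adjoint_pair g g T T' & positive_sqrt g (T' \o T) A.

Definition partial_isometry V (g : inner_product V) (U : V -> V) : Prop :=
  bounded_op g g U /\
  forall x, (forall z, U z = 0 -> g x z = 0) ->
    `|U x : ip_space g| = `|x : ip_space g|.

Definition polar_decomposition V (g : inner_product V)
    (T U A : {linear V -> V}) : Prop :=
  [/\ modulus g T A, partial_isometry g U, forall x, T x = U (A x)
    & forall x, U x = 0 <-> T x = 0].

Definition reduced_solution U V (gU : inner_product U) (gV : inner_product V)
    (Q : V -> V) (b x : U -> V) : Prop :=
  [/\ bounded_op gU gV x, forall t, b t = Q (x t),
      forall t, x t = 0 <-> b t = 0
    & range x `<=` closure (range Q : set (ip_space gV))].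

Section SchurComplement.
Variables (V : lmodType R[i]) (g : inner_product V) (S : lsubspace V).
Local Notation T := (orthocompl g S).

(* [A] is |a| and [Q] is |a|^(1/2); [b'] is the adjoint of [b] when [B] is
   selfadjoint.                                                                *)
Definition hilbert_weakly_complementable (B : {linear V -> V}) : Prop :=
  exists (a A Q : {linear S -> S}) (b : {linear T -> S})
         (b' : {linear S -> T}) (c : {linear T -> T}),
    [/\ block_form B a b b' c, modulus (restr g S) a A,
        positive_sqrt (restr g S) A Q & range b `<=` range Q].

Definition hilbert_schur_complement (B X : {linear V -> V}) : Prop :=
  exists (a A Q u : {linear S -> S}) (b x : {linear T -> S})
         (b' x' : {linear S -> T}) (c : {linear T -> T}),
    [/\ block_form B a b b' c,
        polar_decomposition (restr g S) a u A /\
        positive_sqrt (restr g S) A Q,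
        reduced_solution (restr g T) (restr g S) Q b x,
        adjoint_pair (restr g T) (restr g S) x x'
      & block_form (S := S) (T := T) X (fun=> 0) (fun=> 0) (fun=> 0)
          (fun t => c t - x' (u (x t)))].

End SchurComplement.
End HilbertSpace.

Section KreinSpace.
Context (R : realType) (V : lmodType R[i]).
Variable f : hermitian_form V.

Definition fundamental_decomposition (Vp Vm : lsubspace V) : Prop :=
  [/\ direct_sum Vp Vm, forall (x : Vp) (y : Vm), f (val x) (val y) = 0,
      hilbert_space (restr f Vp)
    & hilbert_space (fun x y : Vm => - restr f Vm x y)].

Definition krein_space : Prop :=
  exists Vp Vm : lsubspace V, fundamental_decomposition Vp Vm.

Record signature := Signature {
  signature_op :> {linear V -> V};
  signatureP : exists Vp Vm : lsubspace V,
    fundamental_decomposition Vp Vm /\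
    forall (x : Vp) (y : Vm), signature_op (val x + val y) = val x - val y }.

Definition ip (J : signature) (x y : V) : R[i] := f (J x) y.

Section SignatureInnerProduct.
Variable J : signature.

Fact ip_zmodl (y : V) : zmod_morphism ((ip J)^~ y).
Proof. by move=> x x'; rewrite /ip raddfB linearBl. Qed.

Fact ip_zmodr (x : V) : zmod_morphism (ip J x).
Proof. by move=> y y'; rewrite /ip raddfB. Qed.

Fact ip_scalel (y : V) : scalable_for *%R ((ip J)^~ y).
Proof. by move=> a x; rewrite /ip linearZ linearZl_LR. Qed.

Fact ip_scaler (x : V) : scalable_for (conjC \; *%R) (ip J x).
Proof. by move=> a y; rewrite /ip linearZ. Qed.

HB.instance Definition _ := isBilinear.Build R[i] V V R[i] *%R (conjC \; *%R)
  (ip J) ip_zmodl ip_zmodr ip_scalel ip_scaler.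

Fact ip_hermitian (x y : V) : ip J x y = (-1) ^+ false * conjC (ip J y x).
Proof.
have fC u v : f u v = conjC (f v u).
  by rewrite hermitian_subproof expr0 mul1r.
have [Vp [Vm [[[sum _] orth _ _] JE]]] := signatureP J.
have [xp [xm ->]] := sum x; have [yp [ym ->]] := sum y.
rewrite expr0 mul1r /ip !JE -fC.
rewrite !linearDl !linearNl !raddfD !raddfN /=.
rewrite (fC (val xm) (val yp)) !orth conjC0.
by rewrite oppr0 addr0.
Qed.

HB.instance Definition _ := isHermitianSesquilinear.Build R[i] V false conjC
  (ip J) ip_hermitian.

Fact ip_dnorm_gt0 (x : V) : x != 0 -> 0 < ip J x x.
Proof.
have fC u v : f u v = conjC (f v u).
  by rewrite hermitian_subproof expr0 mul1r.
have [Vp [Vm [[[sum _] orth [gp [gpE _ _]] [gm [gmE _ _]]] JE]]] := signatureP J.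
have [xp [xm ->]] := sum x => x0.
rewrite /ip JE linearBl !raddfD /= (fC (val xm) (val xp)) !orth conjC0.
rewrite oppr0 addr0 add0r -[f (val xp) _]/(restr f Vp xp xp).
rewrite -[f (val xm) _]/(restr f Vm xm xm) gpE gmE.
have [xp0|xp0] := eqVneq xp 0; last first.
  by rewrite ltr_wpDr ?dnorm_ge0// neq0_dnorm_gt0.
rewrite xp0 linear0l add0r neq0_dnorm_gt0//.
by apply: contraNneq x0 => xm0; rewrite xp0 xm0 !raddf0 addr0.
Qed.

HB.instance Definition _ := isDotProduct.Build R[i] V (ip J) ip_dnorm_gt0.

End SignatureInnerProduct.
End KreinSpace.

Section KreinOperators.
Context (R : realType).
Implicit Types U V : lmodType R[i].

(* All the norms given by signature operators are equivalent, so one choice of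
   [J] and [J'] is enough.                                                     *)
Definition krein_bounded U V (fU : hermitian_form U) (fV : hermitian_form V)
    (T : U -> V) : Prop :=
  exists (J : signature fU) (J' : signature fV), bounded_op (ip J) (ip J') T.

Definition regular_subspace V (f : hermitian_form V) (S : lsubspace V) : Prop :=
  (exists J : signature f,
    closed (lsubspace_set S : set (ip_space (ip J)))) /\
  krein_space (restr f S).

(* [A] is |J T| and [Q] is |J T|^(1/2); [K] is the closure of the range of |J T|
   with the indefinite metric [fK] for which the restriction of [U] to [K] is
   the signature operator.                                                     *)
Definition polar_factorization V (f : hermitian_form V) (T : {linear V -> V})
    (K : lsubspace V) (fK : hermitian_form K) (D : K -> V) : Prop :=
  exists (J : signature f) (U A Q : {linear V -> V}),
    [/\ polar_decomposition (ip J) (J \o T) U A, positive_sqrt (ip J) A Q,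
        lsubspace_set K = closure (range A : set (ip_space (ip J))),
        forall k k' : K, fK k k' = ip J (U (val k)) (val k')
      & forall k : K, D k = J (Q (val k))].

Definition weakly_complementable V (f : hermitian_form V) (S : lsubspace V)
    (W : {linear V -> V}) : Prop :=
  exists J : signature f, hilbert_weakly_complementable (ip J) S (J \o W).

Definition schur_complement V (f : hermitian_form V) (S : lsubspace V)
    (W X : {linear V -> V}) : Prop :=
  exists (J : signature f) (Y : {linear V -> V}),
    hilbert_schur_complement (ip J) S (J \o W) Y /\ forall x, X x = J (Y x).

End KreinOperators.

(* Main.v *)
(* Write [w] for the form [f (W x) y] restricted to a regular [S].  In every Hilbert
   space structure on [S] the modulus of the Gram operator [a] of [w] gives a
   seminorm [| |a|^(1/2) s |].  Heinz' inequality (|B x| <= |A x| implies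
   B <= A for positive A, B) makes these seminorms equivalent as the structure
   varies.  As [v] lies in the range of a selfadjoint [Q] exactly when [<v, s>]
   is bounded by a multiple of [|Q s|], both range inclusions say that each
   functional [f (W t) _] on [S] is bounded for that seminorm.  The Schur
   complement form is [f (W x) y - <u xi, eta>], where [xi] and [eta] represent the
   functionals of [x] and [y]; the last term is the extension by continuity of
   the form dual to [w] and does not depend on the structure either.

   For the converse, and to get a signature on [S^[perp]], a signature of [S] is
   extended to one of the whole space: its positive and then its negative part
   is enlarged to a maximal uniformly definite subspace.  Boundedness always
   comes from the uniform boundedness principle. *)
Require Import Defs.
From HB Require Import structures.
From mathcomp Require Import all_boot all_order all_algebra.
From mathcomp Require Import sesquilinear complex ring lra.
From mathcomp Require Import all_classical all_reals all_analysis.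

Set Implicit Arguments.
Unset Strict Implicit.
Unset Printing Implicit Defensive.

Import Order.TTheory GRing.Theory Num.Theory Num.Def.
Import numFieldNormedType.Exports.

Local Open Scope classical_set_scope.
Local Open Scope complex_scope.
Local Open Scope ring_scope.

(** * Real parts of Hermitian forms *)

(** [hilbert_weakly_complementable] and [hilbert_schur_complement] split the space along the
    complement of [S] for [ip J]. For a general signature [J] this is not [orthocompl f S], so the
    blocks of [J \o W] are not those of [W], and an arbitrary [J] is accessible only through the
    form [f (W x) y]. If [J] maps [S] to itself, the two complements coincide and the blocks of
    [J \o W] are those of [W] followed by [J]; if [J] moreover restricts to the signature of the
    polar factorization, the operators [A], [Q], [U] given with [d] serve as the Hilbert space data.
    Hence no modulus, square root or polar decomposition is ever constructed: uniqueness and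
    comparison are enough, and both rest on Heinz' inequality instead of functional calculus.
    Estimates are made on real parts, which lie in the ordered field [R] and still determine a
    Hermitian form. *)

Lemma quad_discr (R : realType) (a b c : R) :
  (forall s t : R, 0 <= s ^+ 2 * a + 2 * s * t * b + t ^+ 2 * c) -> b ^+ 2 <= a * c.
Proof.
move=> h.
have a0 : 0 <= a by have := h 1 0; rewrite expr1n mul1r !(mulr0, mul0r) expr0n/= !mul0r !addr0.
have cge : 0 <= c by have := h 0 1; rewrite expr1n mul1r !(mulr0, mul0r) expr0n/= !mul0r !add0r.
have [c0|c0] := eqVneq c 0.
  (* At [s = b], [t = - (a + 1)] and [c = 0] the hypothesis reads [0 <= - (a + 2) * b ^+ 2], so [b]
     vanishes. *)
  by have := h 1 (- (a + 1) * b); have := h b (- (a + 1)); rewrite c0 mulr0; nra.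
have cp : 0 < c by rewrite lt0r c0.
have := h c (- b); rewrite (_ : _ + _ = c * (a * c - b ^+ 2)); last by ring.
by rewrite pmulr_rge0// subr_ge0.
Qed.

Section RealPart.
Context (R : realType) (V : lmodType R[i]).
Implicit Types (f : hermitian_form V) (g : inner_product V).

Definition rip (f : V -> V -> R[i]) (x y : V) : R := complex.Re (f x y).

Lemma herm_sym f x y : f x y = conjC (f y x).
Proof. by rewrite hermitian_subproof expr0 mul1r. Qed.

Lemma herm_orthC f x y : f x y = 0 -> f y x = 0.
Proof. by move=> xy; rewrite herm_sym xy conjC0. Qed.

Lemma ripC f x y : rip f x y = rip f y x.
Proof. by rewrite /rip herm_sym; case: (f y x). Qed.

Lemma ripDl f x y z : rip f (x + y) z = rip f x z + rip f y z.
Proof. by rewrite /rip linearDl /= raddfD. Qed.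

Lemma ripNl f x z : rip f (- x) z = - rip f x z.
Proof. by rewrite /rip linearNl /= raddfN. Qed.

Lemma ripBl f x y z : rip f (x - y) z = rip f x z - rip f y z.
Proof. by rewrite ripDl ripNl. Qed.

Lemma rip0l f z : rip f 0 z = 0.
Proof. by rewrite /rip linear0l. Qed.

Lemma ripDr f x y z : rip f z (x + y) = rip f z x + rip f z y.
Proof. by rewrite ![rip f z _]ripC ripDl. Qed.

Lemma ripNr f x z : rip f z (- x) = - rip f z x.
Proof. by rewrite ![rip f z _]ripC ripNl. Qed.

Lemma ripBr f x y z : rip f z (x - y) = rip f z x - rip f z y.
Proof. by rewrite ripDr ripNr. Qed.

Lemma rip0r f z : rip f z 0 = 0.
Proof. by rewrite ripC rip0l. Qed.

Lemma Re_realM (a : R) (z : R[i]) : complex.Re (a%:C * z) = a * complex.Re z.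
Proof. by case: z => u v; rewrite /= mul0r subr0. Qed.

Lemma ripZl f (a : R) x z : rip f (a%:C *: x) z = a * rip f x z.
Proof. by rewrite /rip linearZl_LR/= Re_realM. Qed.

Lemma ripZr f (a : R) x z : rip f z (a%:C *: x) = a * rip f z x.
Proof. by rewrite ![rip f z _]ripC ripZl. Qed.

(** The second argument releases the factor [i] as [- i], which turns the imaginary part of [f x y]
    into a real part; identities therefore need only be checked for [rip]. *)
Lemma herm_ripE f x y : f x y = rip f x y +i* rip f x ('i%C *: y).
Proof.
rewrite /rip linearZr_LR /=; case: (f x y) => a b; congr (_ +i* _) => /=.
by rewrite mul0r mulN1r sub0r opprK.
Qed.

Lemma herm_eq0 f x (N : lsubspace V) :
  (forall y, lsubspace_set N y -> rip f x y = 0) ->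
  forall y, lsubspace_set N y -> f x y = 0.
Proof.
move=> h y Ny; rewrite herm_ripE !h//; apply/set_mem.
by apply: (@rpredZ _ _ (lsubspace_pred N)); apply/mem_set.
Qed.

Lemma rip_quad f x y (t : R) : rip f (x - t%:C *: y) (x - t%:C *: y) =
  rip f x x - 2 * t * rip f x y + t ^+ 2 * rip f y y.
Proof. by rewrite ripBl !ripBr !ripZl !ripZr [rip f y x]ripC; ring. Qed.

Definition nrm g x : R := Num.sqrt (rip g x x).

Lemma rip_ge0 g x : 0 <= rip g x x.
Proof. by have := dnorm_ge0 g x; rewrite /rip; case: (g x x) => a b /=; rewrite lecE => /andP[]. Qed.

Lemma gxx g x : g x x = (rip g x x)%:C.
Proof.
have := dnorm_ge0 g x; rewrite /rip; case: (g x x) => a b /=.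
by rewrite lecE => /= /andP[/eqP-> _].
Qed.

Lemma nrm_ge0 g x : 0 <= nrm g x. Proof. exact: sqrtr_ge0. Qed.

Lemma nrmE g x : rip g x x = nrm g x ^+ 2.
Proof. by rewrite sqr_sqrtr// rip_ge0. Qed.

Lemma nrm0 g : nrm g 0 = 0. Proof. by rewrite /nrm rip0l sqrtr0. Qed.

Lemma nrm_eq0 g x : nrm g x = 0 -> x = 0.
Proof.
move=> n0; apply/eqP; rewrite -(dnorm_eq0 g) gxx nrmE n0 expr0n/=.
by rewrite eqxx.
Qed.

Lemma nrm_gt0 g x : x != 0 -> 0 < nrm g x.
Proof. by move=> x0; rewrite lt0r nrm_ge0 andbT; apply: contraNneq x0 => /nrm_eq0->. Qed.

Lemma nrmN g x : nrm g (- x) = nrm g x.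
Proof. by rewrite /nrm ripNl ripNr opprK. Qed.

Lemma nrmBC g x y : nrm g (x - y) = nrm g (y - x).
Proof. by rewrite -nrmN opprB. Qed.

Lemma nrmZ g (a : R) x : nrm g (a%:C *: x) = `|a| * nrm g x.
Proof. by rewrite /nrm ripZl ripZr mulrA -expr2 sqrtrM ?sqr_ge0// sqrtr_sqr. Qed.

Lemma psd_CS f x y : (forall z, 0 <= rip f z z) ->
  rip f x y ^+ 2 <= rip f x x * rip f y y.
Proof.
move=> f0; apply: quad_discr => s t; have := f0 (s%:C *: x + t%:C *: y).
rewrite ripDl !ripDr !ripZl !ripZr [rip f y x]ripC.
by congr (_ <= _); ring.
Qed.

Lemma rip_CS g x y : rip g x y <= nrm g x * nrm g y.
Proof.
apply: le_trans (ler_norm _) _.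
rewrite -(@ler_pXn2r _ 2) ?nnegrE ?mulr_ge0 ?nrm_ge0//.
by rewrite real_normK ?num_real// exprMn -!nrmE; apply: psd_CS => z; exact: rip_ge0.
Qed.

Lemma rip_CS_abs g x y : `|rip g x y| <= nrm g x * nrm g y.
Proof. by rewrite ler_norml rip_CS andbT lerNl -ripNl -(nrmN g x) rip_CS. Qed.

Lemma nrmD g x y : nrm g (x + y) <= nrm g x + nrm g y.
Proof.
rewrite -(@ler_pXn2r _ 2) ?nnegrE ?addr_ge0 ?nrm_ge0// -nrmE.
rewrite ripDl !ripDr [rip g y x]ripC !nrmE; have := rip_CS g x y; nra.
Qed.

Lemma nrmB g x y : nrm g (x - y) <= nrm g x + nrm g y.
Proof. by rewrite -(nrmN g y) nrmD. Qed.

Lemma nrm_sub g x y z : nrm g (x - z) <= nrm g (x - y) + nrm g (y - z).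
Proof. by rewrite -[x - z](subrKA y) nrmD. Qed.

Lemma nrm_dual g x (M : R) : 0 <= M ->
  (forall y, rip g x y <= M * nrm g y) -> nrm g x <= M.
Proof.
move=> M0 h; have [->|x0] := eqVneq x 0; first by rewrite nrm0.
by rewrite -(ler_pM2r (nrm_gt0 g x0)) -expr2 -nrmE.
Qed.

End RealPart.

(** * Riesz representation and uniform boundedness *)

Section Small.
Context (R : realType).

Lemma le_eps (a b c : R) : (forall e : R, 0 < e -> a <= b + e * c) -> a <= b.
Proof.
move=> h; apply/ler_addgt0Pr => e e0.
have c1 : 0 < `|c| + 1 by rewrite ltr_wpDl.
have := h (e / (`|c| + 1)) (divr_gt0 e0 c1); move=> /le_trans; apply.
rewrite lerD2l mulrAC ler_pdivrMr// ler_pM2l//.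
by rewrite (le_trans (ler_norm c))// lerDl.
Qed.

Lemma inv_small (e : R) : 0 < e -> exists N, forall n, (N <= n)%N -> n.+1%:R^-1 < e.
Proof.
move=> e0; exists (truncn e^-1) => n Nn.
rewrite -[ltRHS]invrK ltf_pV2 ?posrE ?invr_gt0//.
by apply: lt_le_trans (truncnS_gt _) _; rewrite ler_nat.
Qed.

End Small.

Section Sequences.
Context (R : realType) (V : lmodType R[i]).
Implicit Types (g : inner_product V).

(** Sequences and real radii replace filters from here on; [completeP], [closure_adherent] and
    [dense_adherent] translate back. *)
Definition seq_cauchy g (u : nat -> V) := forall e : R, 0 < e ->
  exists N, forall m n, (N <= m)%N -> (N <= n)%N -> nrm g (u m - u n) < e.
Definition seq_lim g (u : nat -> V) (l : V) := forall e : R, 0 < e ->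
  exists N, forall n, (N <= n)%N -> nrm g (u n - l) < e.
Definition seq_complete g := forall u, seq_cauchy g u -> exists l, seq_lim g u l.

Definition adherent g (N : set V) (x : V) :=
  forall e : R, 0 < e -> exists2 n, N n & nrm g (x - n) < e.
Definition closed_in g (N : set V) := forall x, adherent g N x -> N x.

Lemma subspaceD (N : lsubspace V) x y :
  lsubspace_set N x -> lsubspace_set N y -> lsubspace_set N (x + y).
Proof.
move=> Nx Ny; apply/set_mem; apply: (@rpredD _ (lsubspace_pred N)); exact/mem_set.
Qed.

Lemma subspaceZ (N : lsubspace V) a x :
  lsubspace_set N x -> lsubspace_set N (a *: x).
Proof.
move=> Nx; apply/set_mem; apply: (@rpredZ _ _ (lsubspace_pred N)); exact/mem_set.
Qed.

Lemma subspace0 (N : lsubspace V) : lsubspace_set N 0.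
Proof. by apply/set_mem; apply: (@rpred0 _ (lsubspace_pred N)). Qed.

Lemma subspaceN (N : lsubspace V) x : lsubspace_set N x -> lsubspace_set N (- x).
Proof. by rewrite -scaleN1r; exact: subspaceZ. Qed.

Lemma subspaceB (N : lsubspace V) x y :
  lsubspace_set N x -> lsubspace_set N y -> lsubspace_set N (x - y).
Proof. by move=> Nx Ny; apply/subspaceD/subspaceN. Qed.

Lemma valN (N : lsubspace V) (x : N) : lsubspace_set N (val x).
Proof. exact/set_mem/lsubspace_valP. Qed.

End Sequences.

Section Riesz.
Context (R : realType).
Implicit Types U V : lmodType R[i].

Definition linear_of U V (F : U -> V) (l : linear F) : {linear U -> V} :=
  HB.pack F (GRing.isLinear.Build _ _ _ _ F l).

Lemma Re_linear_ext U (phi psi : {linear U -> R[i]^o}) :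
  (forall x, complex.Re (phi x : R[i]) = complex.Re (psi x : R[i])) -> phi =1 psi.
Proof.
move=> h x; have := h ('i%C *: x); have := h x; rewrite !linearZ /GRing.scale/=.
case: (phi x : R[i]) (psi x : R[i]) => [a b] [c d] /= ->.
by rewrite !mul0r !mul1r !sub0r => /oppr_inj ->.
Qed.

(* [xi] is the limit of [Q s] along a minimizing sequence of
   [|Q s|^2 - 2 Re (phi s)]; the case [Q = id] is the usual theorem, and the
   inclusion of a closed subspace gives the orthogonal projection. *)
Lemma riesz_range U V (g : inner_product V) (Q : {linear U -> V})
    (phi : {linear U -> R[i]^o}) (M : R) : seq_complete g ->
  (forall s, complex.Re (phi s : R[i]) <= M * nrm g (Q s)) ->
  exists2 xi, adherent g (range Q) xi & forall s, phi s = g (Q s) xi.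
Proof.
move=> gC phiM; pose ph s := complex.Re (phi s : R[i]).
have phD s t : ph (s + t) = ph s + ph t by rewrite /ph linearD raddfD.
have phZ (a : R) s : ph (a%:C *: s) = a * ph s by rewrite /ph linearZ Re_realM.
have phN s : ph (- s) = - ph s by rewrite /ph linearN raddfN.
pose F s := rip g (Q s) (Q s) - 2 * ph s.
pose D : set R := [set r | exists s, r = F s].
have D0 : has_inf D.
  split; first by exists (F 0), 0.
  exists (- M ^+ 2) => _ [s ->]; rewrite /F nrmE.
  have := phiM s; rewrite -/(ph s); move: (nrm _ _) (ph s) => p q h.
  have := sqr_ge0 (p - M); rewrite sqrrB; lra.
have Dinf s : inf D <= F s by apply: ge_inf; [case: D0|exists s].
(* The square makes the error in [orth] linear in [1/(k+1)]. *)
have /choice[s sP] : forall k : nat, exists s, F s < inf D + (k.+1%:R^-1) ^+ 2.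
  move=> k; have ek : 0 < (k.+1%:R^-1 : R) ^+ 2 by apply: exprn_gt0; rewrite invr_gt0.
  by have [_ [s ->] lt_s] := inf_adherent ek D0; exists s.
(* Along [s k - t h] the functional [F] is a quadratic polynomial in [t] that dips below [F (s k)]
   by at most [1/(k+1)^2]; its discriminant gives an approximate Euler equation. *)
have orth k h : rip g (Q (s k)) (Q h) - ph h <= k.+1%:R^-1 * nrm g (Q h).
  set a := _ - ph h; have Fk := sP k; set b := rip g (Q h) (Q h).
  have FE (t : R) : F (s k - t%:C *: h) = F (s k) - 2 * t * a + t ^+ 2 * b.
    by rewrite /F linearB linearZ /= rip_quad phD phN phZ /a -/b; ring.
  have {Fk}h' (t : R) : 0 <= k.+1%:R^-1 ^+ 2 - 2 * t * a + t ^+ 2 * b.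
    have := Dinf (s k - t%:C *: h); rewrite FE; move: Fk.
    by move: (_ ^+ 2) (2 * t * a) (t ^+ 2 * b) (F _) (inf _) => ? ? ? ? ?; lra.
  have b0 : 0 <= b by exact: rip_ge0.
  apply: le_trans (ler_norm _) _.
  rewrite -(@ler_pXn2r _ 2) ?nnegrE ?mulr_ge0 ?nrm_ge0//.
  rewrite real_normK ?num_real// exprMn -nrmE -/b; move: (k.+1%:R^-1) h' => c h'.
  have [b00|bn0] := eqVneq b 0.
    have Qh0 : nrm g (Q h) = 0 by rewrite /nrm -/b b00 sqrtr0.
    have := phiM h; have := phiM (- h); rewrite -!/(ph _) phN linearN nrmN Qh0 mulr0.
    rewrite /a (nrm_eq0 Qh0) rip0r sub0r sqrrN b00 mulr0 => h1 h2.
    by rewrite (_ : ph h = 0) ?expr0n//; apply/eqP; rewrite eq_le h2 -oppr_le0.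
  have bp : 0 < b by rewrite lt0r bn0.
  have := h' (a / b).
  have -> : c ^+ 2 - 2 * (a / b) * a + (a / b) ^+ 2 * b = (c ^+ 2 * b - a ^+ 2) / b.
    by field.
  by rewrite pmulr_lge0 ?invr_gt0// subr_ge0.
(* Adding [orth] for [k] and [m] in opposite directions cancels [ph]. Only [Q \o s] is Cauchy; [U]
   carries no norm in which [s] could converge. *)
have dist k m : nrm g (Q (s k) - Q (s m)) <= k.+1%:R^-1 + m.+1%:R^-1.
  have [->|d0] := eqVneq (Q (s k) - Q (s m)) 0; first by rewrite nrm0 addr_ge0.
  rewrite -(ler_pM2r (nrm_gt0 g d0)) -expr2 -nrmE -linearB.
  have := orth k (s k - s m); have := orth m (- (s k - s m)).
  rewrite linearN ripNr phN nrmN mulrDl linearB ripBl.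
  move: (rip _ _ _) (rip _ _ _) (ph _) (k.+1%:R^-1 * _) (m.+1%:R^-1 * _).
  by move=> *; lra.
have [xi xiP] : exists xi, seq_lim g (Q \o s) xi.
  apply: gC => e e0; have [N hN] := inv_small (divr_gt0 e0 (ltr0Sn R 1)).
  exists N => m k Nm Nk; apply: le_lt_trans (dist m k) _.
  by have := ltrD (hN _ Nm) (hN _ Nk); rewrite -splitr.
exists xi.
  by move=> e /xiP[N hN]; exists (Q (s N)); [exists (s N)|rewrite nrmBC; exact: hN].
have xiP' h : rip g xi (Q h) - ph h <= 0.
  apply: (@le_eps _ _ _ (2 * nrm g (Q h))) => e e0; rewrite add0r.
  have [N1 h1] := inv_small e0; have [N2 h2] := xiP _ e0.
  set k := maxn N1 N2; have := orth k h; have := h1 k (leq_maxl _ _).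
  have := h2 k (leq_maxr _ _); have := rip_CS_abs g (Q (s k) - xi) (Q h).
  rewrite ripBl ler_norml => /andP[+ _]; have := nrm_ge0 g (Q h).
  rewrite /=; move: (k.+1%:R^-1) (nrm _ _) (nrm _ _) (rip _ _ _) (rip _ _ _) (ph h).
  move=> a b c d t q *; nra.
have lxi : linear (fun x => g (Q x) xi : R[i]^o) by move=> a x y; rewrite linearP linearPl.
apply: (@Re_linear_ext _ phi (linear_of lxi)) => x; rewrite /= -/(rip g (Q x) xi) ripC -/(ph x).
have := xiP' x; have := xiP' (- x); rewrite linearN ripNr phN; lra.
Qed.

Lemma riesz V (g : inner_product V) (phi : {linear V -> R[i]^o}) (M : R) :
  seq_complete g -> (forall x, complex.Re (phi x : R[i]) <= M * nrm g x) ->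
  exists z, forall x, phi x = g x z.
Proof.
move=> gC hM; have [z _ zP] := @riesz_range V V g idfun phi M gC hM; by exists z.
Qed.

Lemma projection V (g : inner_product V) (N : lsubspace V) x : seq_complete g ->
  closed_in g (lsubspace_set N) ->
  exists2 n, lsubspace_set N n & forall n', lsubspace_set N n' -> g (x - n) n' = 0.
Proof.
move=> gC NC.
have lp : linear (fun n : N => g (val n) x : R[i]^o) by move=> a y z; rewrite linearPl.
have [|n rn nP] := @riesz_range N V g val (linear_of lp) (nrm g x) gC.
  by move=> s; rewrite mulrC; exact: rip_CS.
exists n => [|n' Nn'].
  by apply: NC => e /rn[_ [y _ <-] xy]; exists (val y) => //; exact: valN.
have := nP (SubspaceElt (mem_set Nn' : n' \in lsubspace_pred N)).
move=> e; have {}e : g n' x = g n' n by exact: e.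
by rewrite herm_sym /= linearBr /= e subrr conjC0.
Qed.
End Riesz.

Section UniformBoundedness.
Context (R : realType) (V : lmodType R[i]).
Implicit Types (g : inner_product V).

Let r (n : nat) : R := 3^-1 ^+ n.

Let r_gt0 n : 0 < r n. Proof. by rewrite /r exprn_gt0. Qed.

Let rS n : r n.+1 = r n / 3. Proof. by rewrite /r exprSr. Qed.

Let r_small (e : R) : 0 < e -> exists N, r N < e.
Proof.
move=> /inv_small[N hN]; exists N; apply: le_lt_trans (hN _ (leqnn _)).
rewrite /r exprVn lef_pV2 ?posrE ?exprn_gt0// -natrX ler_nat.
exact: ltn_expl.
Qed.

Lemma nrm_lim g u l (a : V) (M : R) : seq_lim g u l ->
  (exists N, forall n, (N <= n)%N -> nrm g (u n - a) <= M) -> nrm g (l - a) <= M.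
Proof.
move=> ul [N1 h1]; apply: (@le_eps _ _ _ 1) => e e0.
have [N2 h2] := ul _ e0; set n := maxn N1 N2.
have := h1 n (leq_maxl _ _); have := h2 n (leq_maxr _ _).
have := nrm_sub g l (u n) a; rewrite (nrmBC g l (u n)).
by move: (nrm _ _) (nrm _ _) (nrm _ _) => ? ? ? *; lra.
Qed.

(* Sokal's gliding hump: adding or subtracting a step of length [3^-n] makes
   [x n.+1] see at least [3^-n |z n|], and the later steps cannot undo it. *)
Lemma weakly_bounded g (Z : set V) : seq_complete g ->
  (forall x, exists M, forall z, Z z -> `|rip g x z| <= M) ->
  exists2 M, 0 <= M & forall z, Z z -> nrm g z <= M.
Proof.
move=> gC wb; apply: contrapT => ub.
have /choice[z zP] : forall n : nat, exists z, Z z /\ n%:R / r n < nrm g z.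
  move=> n; apply: contrapT => nz; apply: ub; exists (n%:R / r n).
    by rewrite divr_ge0// ltW.
  by move=> z Zz; rewrite leNgt; apply/negP => lt; apply: nz; exists z.
have z_gt0 n : 0 < nrm g (z n).
  by have [_] := zP n; apply: le_lt_trans; rewrite divr_ge0// ltW.
pose y n := (r n / nrm g (z n))%:C *: z n.
have ny n : nrm g (y n) = r n.
  rewrite nrmZ ger0_norm ?divr_ge0 ?ltW//.
  by rewrite divfK// gt_eqF.
have yz n : rip g (y n) (z n) = r n * nrm g (z n).
  rewrite ripZl nrmE; have := z_gt0 n; move: (nrm _ _) (r n) => a b a0.
  by field; rewrite gt_eqF.
pose x := fix x n := if n is m.+1 then
  (if 0 <= rip g (x m) (z m) then x m + y m else x m - y m) else 0.
have xz n : r n * nrm g (z n) <= `|rip g (x n.+1) (z n)|.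
  rewrite /=; case: (leP 0 (rip g (x n) (z n))) => h.
    by rewrite ripDl yz (le_trans _ (ler_norm _))// lerDr.
  rewrite -normrN; apply: le_trans (ler_norm _); rewrite ripBl yz opprB lerBrDr.
  by rewrite gerDl ltW.
have xx n : nrm g (x n.+1 - x n) = r n.
  rewrite /=; case: ifP => _; rewrite addrAC subrr add0r ?nrmN; exact: ny.
have xk n k : nrm g (x (n + k)%N - x n) <= 3 / 2 * (r n - r (n + k)%N).
  elim: k => [|k IH]; first by rewrite addn0 !subrr nrm0 mulr0.
  rewrite addnS; apply: le_trans (nrm_sub _ _ (x (n + k)%N) _) _.
  rewrite xx rS; move: IH; move: (nrm _ _) (r n) (r _) => a b c *; lra.
have xn n m : (n <= m)%N -> nrm g (x m - x n) <= 3 / 2 * r n.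
  move=> /subnKC <-; apply: le_trans (xk _ _) _; have := r_gt0 (n + (m - n))%N.
  move: (r _) (r _) => a b *; lra.
have [l xl] : exists l, seq_lim g x l.
  apply: gC => e e0; have [N hN] := r_small (divr_gt0 e0 (ltr0Sn R 2)).
  exists N => m n Nm Nn; apply: le_lt_trans (nrm_sub _ _ (x N) _) _.
  rewrite [X in _ + X]nrmBC; have := xn _ _ Nm; have := xn _ _ Nn.
  move: hN; move: (nrm _ _) (nrm _ _) (r _) => a b c *; lra.
have [M hM] := wb l; have [n Mn] : exists n : nat, 2 * M < n%:R.
  by exists (truncn (2 * M)).+1; exact: truncnS_gt.
have [Zn lt_n] := zP n.
(* The steps after [n.+1] move by at most [3/2 * 3^-(n+1) = 3^-n / 2], half of what is needed to
   undo step [n], so [|<l, z n>| >= 3^-n |z n| / 2 > n / 2 > M]. *)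
have lx : nrm g (l - x n.+1) <= 3 / 2 * r n.+1.
  by apply: (nrm_lim xl); exists n.+1 => m; exact: xn.
have := hM _ Zn; have := xz n; have := rip_CS_abs g (l - x n.+1) (z n).
have : `|rip g (x n.+1) (z n)| <= `|rip g l (z n)| + `|rip g (l - x n.+1) (z n)|.
  have -> : rip g (x n.+1) (z n) = rip g l (z n) - rip g (l - x n.+1) (z n).
    by rewrite -ripBl subKr.
  exact: ler_normB.
have := z_gt0 n; have := r_gt0 n; move: lt_n; rewrite ltr_pdivrMr//.
move: lx; rewrite rS.
move: (nrm _ _) (nrm _ _) (r _) (`|_| : R) (`|_| : R) (`|_| : R) => a b c d e f.
move=> h1 h2 h3 h4 h5 h6 h7 h8.
have h9 : b * a <= 3 / 2 * (c / 3) * a by rewrite ler_wpM2r// ltW.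
by move: Mn h2 h5 h6 h7 h8 h9; move: (n%:R : R) => N *; lra.
Qed.

End UniformBoundedness.

Section Adjoints.
Context (R : realType).
Implicit Types U V : lmodType R[i].

Lemma dot_injr V (g : inner_product V) x y :
  (forall z, g z x = g z y) -> x = y.
Proof.
move=> h; apply/eqP; rewrite -subr_eq0 -(dnorm_eq0 g) linearBr/= h subrr//.
Qed.

Lemma rip_inj V (g : inner_product V) x y :
  (forall z, rip g x z = rip g y z) -> x = y.
Proof.
move=> h; apply/eqP; rewrite -subr_eq0; apply/eqP/(@nrm_eq0 _ _ g).
by rewrite /nrm ripBl h subrr sqrtr0.
Qed.

(** Source of the adjoints, Gram operators and projections below. The bound may depend on [u];
    linearity of [T] comes from uniqueness of the representing vector. *)
Lemma form_representation U V (g : inner_product V) (h : V -> U -> R[i]) :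
  seq_complete g ->
  (forall u a x y, h (a *: x + y) u = a * h x u + h y u) ->
  (forall x a u v, h x (a *: u + v) = conjC a * h x u + h x v) ->
  (forall u, exists M, forall x, complex.Re (h x u) <= M * nrm g x) ->
  exists T : {linear U -> V}, forall x u, h x u = g x (T u).
Proof.
move=> gC hl hr hb.
have /choice[T TP] : forall u, exists z, forall x, h x u = g x z.
  move=> u; have [M hM] := hb u.
  have lu : linear (fun x => h x u : R[i]^o) by move=> a x y; rewrite hl.
  exact: (riesz (phi := linear_of lu) gC hM).
have Tl : linear T.
  move=> a u v; apply: (@dot_injr _ g) => x.
  by rewrite -TP hr linearDr linearZr_LR/= !TP.
by exists (linear_of Tl) => x u; rewrite TP.
Qed.

Definition bnd U V (gU : inner_product U) (gV : inner_product V) (T : U -> V) :=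
  exists2 M : R, 0 <= M & forall x, nrm gV (T x) <= M * nrm gU x.

Lemma adjoint_exists U V (gU : inner_product U) (gV : inner_product V)
  (T : {linear U -> V}) : seq_complete gU -> bnd gU gV T ->
  exists T' : {linear V -> U}, adjoint_pair gU gV T T'.
Proof.
move=> gC [M M0 hM]; have [|||T' hT'] := @form_representation V U gU (fun x v => gV (T x) v) gC.
- by move=> v a x y; rewrite linearP linearPl.
- by move=> x a u v; rewrite linearPr.
- move=> v; exists (M * nrm gV v) => x; apply: le_trans (rip_CS _ _ _) _.
  by rewrite mulrAC ler_wpM2r ?nrm_ge0.
by exists T' => x y; rewrite hT'.
Qed.

Lemma bnd_adjoint U V (gU : inner_product U) (gV : inner_product V)
  (T : U -> V) (T' : V -> U) : bnd gU gV T -> adjoint_pair gU gV T T' ->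
  bnd gV gU T'.
Proof.
move=> [M M0 hM] TT'; exists M => // v; apply: nrm_dual => [|u].
  by rewrite mulr_ge0 ?nrm_ge0.
have -> : rip gU (T' v) u = rip gV (T u) v by rewrite ripC /rip TT'.
apply: le_trans (rip_CS _ _ _) _.
by rewrite mulrAC ler_wpM2r ?nrm_ge0.
Qed.

End Adjoints.

(** * Heinz' inequality *)

Section Heinz.
Context (R : realType) (V : lmodType R[i]).
Implicit Types (g : inner_product V) (P A B Q : {linear V -> V}).

Definition psd g (P : V -> V) := (forall x y, rip g (P x) y = rip g x (P y)) /\
  (forall x, 0 <= rip g (P x) x).

Lemma psd_CS_op g P x y : psd g P ->
  rip g (P x) y ^+ 2 <= rip g (P x) x * rip g (P y) y.
Proof.
move=> [sym pos]; apply: quad_discr => s t.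
have := pos (s%:C *: x + t%:C *: y).
rewrite linearD !linearZ /= ripDl !ripDr !ripZl !ripZr.
rewrite [rip g (P y) x]sym [rip g y _]ripC.
by move: (rip _ _ _) (rip _ _ _) (rip _ _ _) => ? ? ? h; lra.
Qed.

(** Cauchy-Schwarz for the form [<P x, y>] at [y = P x]. A vector where [<P x, x>] is small is thus
    nearly in the kernel of [P], which gives the approximate eigenvector in [heinz1]. *)
Lemma psd_norm_le g P (M : R) x : psd g P -> 0 <= M ->
  (forall x, nrm g (P x) <= M * nrm g x) -> nrm g (P x) ^+ 2 <= M * rip g (P x) x.
Proof.
move=> Ppsd M0 hM; have [_ pos] := Ppsd.
have [->|Px0] := eqVneq (P x) 0.
  by rewrite nrm0 rip0l expr0n/= mulr0.
have := psd_CS_op x (P x) Ppsd; rewrite nrmE.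
have := rip_CS g (P (P x)) (P x); have := hM (P x); have := nrm_gt0 g Px0.
have := pos x; move: (rip _ _ _) (rip _ _ _) (nrm _ _) (nrm _ _) => b a c d.
move=> a0 d0 cd bc h.
have b1 : b <= M * d ^+ 2 by nra.
have h1 : d ^+ 2 ^+ 2 <= a * (M * d ^+ 2) by apply: le_trans h _; rewrite ler_wpM2l.
have d2 : 0 < d ^+ 2 by rewrite exprn_gt0.
by rewrite -(ler_pM2r d2) -expr2; move: h1; lra.
Qed.

(* Were [lam := sup {<(B - A) x, x> : |x| <= 1}] positive, it would be an
   approximate eigenvalue of [B - A], whereas
   [Re <(B + A) x, (B - A) x> = |B x|^2 - |A x|^2 <= 0]. *)
Lemma heinz1 g A B : bnd g g A -> bnd g g B -> psd g A -> psd g B ->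
  (forall x, nrm g (B x) <= nrm g (A x)) ->
  forall x, rip g (B x) x <= rip g (A x) x.
Proof.
move=> [MA MA0 hA] [MB MB0 hB] [symA posA] [symB posB] BA x0.
rewrite leNgt; apply/negP => lt0.
set m := MA + MB; have m0 : 0 <= m by rewrite addr_ge0.
pose D x := B x - A x.
have hD x : nrm g (D x) <= m * nrm g x.
  apply: le_trans (nrmB _ _ _) _; have := hA x; have := hB x; rewrite /m; lra.
have hS x : nrm g (B x + A x) <= m * nrm g x.
  apply: le_trans (nrmD _ _ _) _; have := hA x; have := hB x; rewrite /m; lra.
have Dx0 : 0 < rip g (D x0) x0 by rewrite ripBl subr_gt0.
have x0n : 0 < nrm g x0.
  by apply: nrm_gt0; apply: contraTneq Dx0 => ->; rewrite rip0r ltxx.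
have DZ (a : R) x : rip g (D (a%:C *: x)) (a%:C *: x) = a ^+ 2 * rip g (D x) x.
  have -> : D (a%:C *: x) = a%:C *: D x by rewrite /D scalerBr !linearZ.
  by rewrite ripZl ripZr; ring.
pose E : set R := [set r | exists2 x, nrm g x <= 1 & r = rip g (D x) x].
have E0 : has_sup E.
  split; first by exists (rip g (D 0) 0), 0 => //; rewrite nrm0.
  exists m => _ [x x1 ->]; apply: le_trans (rip_CS _ _ _) _.
  have := hD x; have := nrm_ge0 g x; have := nrm_ge0 g (D x); move: x1.
  move: (nrm _ _) (nrm _ _) => a b *; nra.
set lam := sup E.
have Elam r : E r -> r <= lam by move=> Er; apply: ub_le_sup => //; case: E0.
have lamD x : rip g (D x) x <= lam * rip g x x.
  have [->|x0'] := eqVneq x 0; first by rewrite !rip0r mulr0.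
  have xn := nrm_gt0 g x0'.
  have : E (rip g (D ((nrm g x)^-1%:C *: x)) ((nrm g x)^-1%:C *: x)).
    exists ((nrm g x)^-1%:C *: x) => //.
    by rewrite nrmZ ger0_norm ?invr_ge0 ?(ltW xn)// mulVf ?lexx ?lt0r_neq0.
  by move/Elam; rewrite DZ exprVn mulrC ler_pdivrMr ?exprn_gt0// -nrmE.
have lam0 : 0 < lam.
  have := lt_le_trans Dx0 (lamD x0); rewrite pmulr_lgt0// nrmE exprn_gt0//.
pose P := (lam%:C \*: idfun \- (B \- A)) : {linear V -> V}.
have PE x : P x = lam%:C *: x - D x by [].
have Ppsd : psd g P.
  split=> [x y|x]; rewrite !PE ?ripBl ?ripBr ?ripZl ?ripZr; last first.
    by have := lamD x; rewrite /D ripBl subr_ge0.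
  by rewrite symA symB.
set M := lam + m; have M0 : 0 <= M by rewrite addr_ge0// ltW.
have hP x : nrm g (P x) <= M * nrm g x.
  rewrite PE; apply: le_trans (nrmB _ _ _) _; rewrite nrmZ (ger0_norm (ltW lam0)).
  by rewrite mulrDl lerD2l.
suff : lam ^+ 2 ^+ 2 / 4 <= 0.
  by apply/negP; rewrite -ltNge divr_gt0// !exprn_gt0.
apply: (@le_eps _ _ _ (m ^+ 2 * M)) => e e0; rewrite add0r.
(* [d <= e] makes [P x] small, and [d <= lam / 2] keeps [<D x, x>] above [lam / 2]. *)
set d := Num.min e (lam / 2).
have d0 : 0 < d by rewrite lt_min e0 divr_gt0.
have [_ [x x1 ->] ltx] := sup_adherent d0 E0; rewrite -/lam in ltx.
have h1 := psd_norm_le x Ppsd M0 hP.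
have h2 : rip g (P x) x <= d.
  rewrite PE ripBl ripZl; have : rip g x x <= 1 by rewrite nrmE expr_le1 ?nrm_ge0.
  move: ltx lam0; move: (rip _ _ _) (rip _ _ _) => a b *; nra.
have h3 : rip g (B x + A x) (D x) <= 0.
  rewrite ripDl !ripBr [rip g (A x) (B x)]ripC !nrmE.
  have := BA x; have := nrm_ge0 g (B x); move: (nrm _ _) (nrm _ _) => a b *; nra.
(* Substituting [D x = lam x - P x] into [h3] bounds [lam <(B + A) x, x>] by [<(B + A) x, P x>]. *)
have h4 : lam * (lam / 2) <= m * nrm g (P x).
  have := rip_CS g (B x + A x) (P x); rewrite {1}PE ripBr ripZr.
  have h5 : lam / 2 <= rip g (B x + A x) x.
    have -> : B x + A x = D x + (A x + A x) by rewrite /D addrA subrK.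
    rewrite (ripDl g (D x)) (ripDl g (A x)); have := posA x; have : d <= lam / 2 by rewrite ge_min lexx orbT.
    move: ltx; lra.
  have h6 : lam * (lam / 2) <= lam * rip g (B x + A x) x by rewrite ler_pM2l.
  have h7 : nrm g (B x + A x) * nrm g (P x) <= m * nrm g (P x).
    rewrite ler_wpM2r ?nrm_ge0//; apply: le_trans (hS x) _.
    by rewrite ler_piMr.
  lra.
have h8 : (lam * (lam / 2)) ^+ 2 <= m ^+ 2 * (M * d).
  have := nrm_ge0 g (P x); have : M * rip g (P x) x <= M * d by rewrite ler_wpM2l.
  move: h1 h4; move: (rip _ _ _) (nrm _ _) => a b h1 h4 h5 b0.
  have l0 : 0 <= lam * (lam / 2) by rewrite mulr_ge0// ?divr_ge0// ltW.
  have : (lam * (lam / 2)) ^+ 2 <= (m * b) ^+ 2 by rewrite ler_pXn2r// nnegrE mulr_ge0.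
  rewrite [in X in _ <= X -> _]exprMn => /le_trans; apply; rewrite ler_wpM2l ?sqr_ge0//.
  exact: le_trans h1 h5.
have -> : lam ^+ 2 ^+ 2 / 4 = (lam * (lam / 2)) ^+ 2 by field.
apply: le_trans h8 _; rewrite mulrA [leRHS]mulrC ler_wpM2l ?ge_min ?lexx//.
by rewrite mulr_ge0// sqr_ge0.
Qed.

Lemma heinz g A B (k : R) : bnd g g A -> bnd g g B -> psd g A -> psd g B ->
  0 <= k -> (forall x, nrm g (B x) <= k * nrm g (A x)) ->
  forall x, rip g (B x) x <= k * rip g (A x) x.
Proof.
move=> [MA MA0 hA] bB [symA posA] pB k0 BA x.
have := @heinz1 g (k%:C \*: A) B _ bB _ pB _ x; rewrite /= ripZl; apply.
- exists (k * MA); first exact: mulr_ge0.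
  by move=> y; rewrite /= nrmZ ger0_norm// -mulrA ler_wpM2l.
- split=> [y z|y] /=; first by rewrite ripZl ripZr symA.
  by rewrite ripZl mulr_ge0.
- by move=> y; rewrite /= nrmZ ger0_norm.
Qed.

Lemma psd_eq g A B : psd g A -> psd g B ->
  (forall x, rip g (A x) x = rip g (B x) x) -> A =1 B.
Proof.
move=> [symA _] [symB _] AB x; apply: (@rip_inj _ _ g) => y.
have := AB (x + y); rewrite !linearD/= !ripDl !ripDr !AB.
rewrite [rip g (A y) x]symA [rip g (B y) x]symB ![rip g y _]ripC.
by move: (rip _ _ _) (rip _ _ _) (rip _ _ _) (rip _ _ _) => *; lra.
Qed.

(** Equal squares give [|A x| = |B x|], and Heinz' inequality applied both ways then equates the
    quadratic forms. *)
Lemma sqrt_unique g A B : bnd g g A -> bnd g g B -> psd g A -> psd g B ->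
  (forall x, A (A x) = B (B x)) -> A =1 B.
Proof.
move=> bA bB pA pB AB.
have nAB x : nrm g (A x) = nrm g (B x).
  have [[symA _] [symB _]] := (pA, pB).
  by rewrite /nrm -[RHS]/(Num.sqrt _) symA AB -symB.
apply: (psd_eq pA pB) => x; apply/eqP; rewrite eq_le.
by rewrite !(heinz1 _ _ _ _)// => y; rewrite nAB.
Qed.

End Heinz.

(** * The topology of an inner product *)

Section Topology.
Context (R : realType).
Implicit Types U V : lmodType R[i].

Lemma ip_normE V (g : inner_product V) (x : V) : `|x : ip_space g| = (nrm g x)%:C.
Proof.
change (`|x : ip_space g|) with (sqrtC (g x x)).
by rewrite gxx nrmE rmorphXn /= sqrCK// lecR nrm_ge0.
Qed.

Lemma bounded_opP U V (gU : inner_product U) (gV : inner_product V) (T : U -> V) :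
  bounded_op gU gV T <-> bnd gU gV T.
Proof.
split=> [[M hM]|[M M0 hM]]; last first.
  by exists M => x; rewrite !ip_normE -rmorphM /= lecR.
exists `|M| => // x; have := hM x; rewrite !ip_normE -rmorphM /= lecR => /le_trans; apply.
by rewrite ler_wpM2r ?nrm_ge0// ler_norm.
Qed.

Lemma ball_nrm V (g : inner_product V) (x y : V) (e : R) :
  ball (x : ip_space g) e%:C y <-> nrm g (x - y) < e.
Proof.
rewrite -ball_normE /ball_ /=.
change (`|(x : ip_space g) - y|) with (`|(x - y) : ip_space g|).
by rewrite ip_normE ltcR.
Qed.

Lemma pos_complex (e : R[i]) : 0 < e -> exists2 d : R, 0 < d & e = d%:C.
Proof.
case: e => a b; rewrite ltcE /= => /andP[/eqP -> a0]; by exists a.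
Qed.

Lemma nbhs_nrm V (g : inner_product V) (x : V) (A : set V) :
  nbhs (x : ip_space g) A <-> exists2 e : R, 0 < e & forall y, nrm g (x - y) < e -> A y.
Proof.
rewrite -nbhs_ballE; split=> [[e /= /pos_complex[d d0 ->] hA]|[e e0 hA]].
  by exists d => // y /ball_nrm /hA.
exists e%:C; first by rewrite /= ltcR.
by move=> y /ball_nrm /hA.
Qed.

Lemma closure_adherent V (g : inner_product V) (A : set V) (x : V) :
  closure (A : set (ip_space g)) x <-> adherent g A x.
Proof.
split=> [cx e e0|ax B /nbhs_nrm[e e0 eB]].
  have /cx[y [Ay /= xy]] : nbhs (x : ip_space g) [set y | nrm g (x - y) < e].
    by apply/nbhs_nrm; exists e.
  by exists y.
by have [y Ay xy] := ax _ e0; exists y; split=> //; exact: eB.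
Qed.

Lemma closedP V (g : inner_product V) (A : set V) :
  closed (A : set (ip_space g)) <-> closed_in g A.
Proof.
split=> [cA x /closure_adherent|cA]; first by move/(closure_id _).1: cA => <-.
by move=> x /closure_adherent /cA.
Qed.

Definition separable V (g : inner_product V) :=
  exists2 D : set V, countable D & forall x, adherent g D x.

Lemma dense_adherent V (g : inner_product V) (D : set V) :
  dense (D : set (ip_space g)) <-> forall x, adherent g D x.
Proof.
split=> [dD x e e0|dD O [x Ox] oO].
  have [] := dD (ball (x : ip_space g) e%:C).
  - by exists x; apply: ballxx; rewrite ltcR.
  - by apply: ball_open; rewrite ltcR.
  by move=> y [/ball_nrm xy Dy]; exists y.
have /nbhs_nrm[e e0 eO] : nbhs (x : ip_space g) O by exact: open_nbhs_nbhs.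
by have [y Dy xy] := dD x _ e0; exists y; split=> //; exact: eO.
Qed.

Lemma completeP V (g : inner_product V) :
  (forall F : set_system (ip_space g), ProperFilter F -> cauchy F -> cvg F) <->
  seq_complete g.
Proof.
split=> [cg u uc|cg F FF Fc].
  have FF : ProperFilter ((u : nat -> ip_space g) @ \oo) by exact: fmap_proper_filter.
  have /cvg_ex[/= l ul] : cvg ((u : nat -> ip_space g) @ \oo).
    apply: cg; apply: cauchy_exP => _ /pos_complex[e e0 ->].
    have [N hN] := uc _ e0; exists (u N); exists N => // n /= Nn.
    by apply/ball_nrm; exact: hN.
  exists l => e e0.
  have /ul [N _ hN] : nbhs (l : ip_space g) [set y | nrm g (l - y) < e].
    by apply/nbhs_nrm; exists e.
  by exists N => n Nn; rewrite nrmBC; apply: hN.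
(* A Cauchy filter contains a ball of each radius [1/(n+1)]. Any two of these balls meet, so their
   centres form a Cauchy sequence, and the filter converges to its limit. *)
have /choice[x xP] : forall n : nat, exists x : V,
    F [set y | nrm g (x - y) < n.+1%:R^-1].
  move=> n; have e0 : 0 < (n.+1%:R^-1%:C : R[i]) by rewrite ltcR invr_gt0.
  have [x Fx] := (cauchyP F).1 Fc _ e0.
  by exists x; apply: filterS Fx => y /ball_nrm.
have dx n m : nrm g (x n - x m) < n.+1%:R^-1 + m.+1%:R^-1.
  have [y [/= h1 h2]] := filter_ex (filterI (xP n) (xP m)).
  by apply: le_lt_trans (nrm_sub _ _ y _) _; rewrite (nrmBC g y) ltrD.
have [l xl] : exists l, seq_lim g x l.
  apply: cg => e e0; have [N hN] := inv_small (divr_gt0 e0 (ltr0Sn R 1)).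
  exists N => m k Nm Nk; apply: lt_trans (dx m k) _.
  by have := ltrD (hN _ Nm) (hN _ Nk); rewrite -splitr.
apply/cvg_ex; exists (l : ip_space g) => A /nbhs_nrm[e e0 eA].
have e2 : 0 < e / 2 by rewrite divr_gt0.
have [N1 h1] := inv_small e2; have [N2 h2] := xl _ e2.
set n := maxn N1 N2; apply: filterS (xP n) => y /= xy; apply: eA.
apply: le_lt_trans (nrm_sub _ _ (x n) _) _; rewrite (nrmBC g l) [e]splitr ltrD//.
  exact/h2/leq_maxr.
by apply: lt_trans xy _; exact/h1/leq_maxl.
Qed.

Lemma hilbert_spaceP V (h : V -> V -> R[i]) : hilbert_space h <->
  exists g : inner_product V, [/\ forall x y, h x y = g x y, seq_complete g & separable g].
Proof.
by split=> -[g [hg]] => [/completeP gc|/completeP gc] [D Dc Dd];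
  exists g; split=> //; exists D => //; exact/dense_adherent.
Qed.

End Topology.

(** * Polar decompositions *)

Section Polar.
Context (R : realType) (V : lmodType R[i]).
Variable g : inner_product V.
Implicit Types (A B P Q T : {linear V -> V}).

(** Polarization: reality at [x + y] settles the imaginary parts, reality at [i x + y] the real
    parts. *)
Lemma real_form_sym (h : V -> V -> R[i]) :
  (forall a x y z, h (a *: x + y) z = a * h x z + h y z) ->
  (forall a x y z, h z (a *: x + y) = conjC a * h z x + h z y) ->
  (forall x, complex.Im (h x x) = 0) -> forall x y, h x y = conjC (h y x).
Proof.
move=> hl hr h0 x y.
have := h0 ('i%C *: x + y); have := h0 (1 *: x + y).
rewrite !hl !hr; have := h0 x; have := h0 y; rewrite conjC1 !mul1r.
case: (h x x) (h y y) (h x y) (h y x) => [a a'] [b b'] [c c'] [d d'] /=.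
move=> -> ->; rewrite !(mul0r, mul1r, mulr0, mulr1, add0r, addr0, sub0r, oppr0, opprK).
move=> h1 h2; apply/eqP; rewrite eq_complex/=; apply/andP; split; apply/eqP; lra.
Qed.

Lemma pos_sym T : (forall x, 0 <= g (T x) x) -> adjoint_pair g g T T.
Proof.
move=> T0 x y; rewrite [RHS]herm_sym /=.
apply: (@real_form_sym (fun x y => g (T x) y)) => [a u v w|a u v w|u].
- by rewrite linearP linearPl.
- by rewrite linearPr.
- by have := T0 u; rewrite lecE => /andP[/eqP].
Qed.

Lemma positive_sqrtP P Q : positive_sqrt g P Q ->
  [/\ bnd g g Q, psd g Q, adjoint_pair g g Q Q & forall x, Q (Q x) = P x].
Proof.
move=> [/bounded_opP bQ Q0 QQ]; have Qs := pos_sym Q0; split=> //; split=> [x y|x].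
  by rewrite /rip Qs.
by have := Q0 x; rewrite lecE => /andP[_].
Qed.

Lemma adjoint_unique U (gU : inner_product U) (T : U -> V) (S1 S2 : V -> U) :
  adjoint_pair gU g T S1 -> adjoint_pair gU g T S2 -> S1 =1 S2.
Proof. by move=> h1 h2 x; apply: (@dot_injr _ _ gU) => z; rewrite -h1 h2. Qed.

Lemma modulusP T A : adjoint_pair g g T T -> modulus g T A ->
  [/\ bnd g g A, psd g A, adjoint_pair g g A A & forall x, A (A x) = T (T x)].
Proof.
move=> Ts [T' TT' /positive_sqrtP[bA pA sA AA]]; split=> // x.
by rewrite AA /= (adjoint_unique TT' Ts).
Qed.

Lemma psd_ker Q x : adjoint_pair g g Q Q -> Q (Q x) = 0 -> Q x = 0.
Proof.
move=> sQ QQ0; apply: (@nrm_eq0 _ _ g).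
by rewrite /nrm /rip sQ QQ0 linear0r sqrtr0.
Qed.

Lemma adherent_ker (U : lmodType R[i]) (gU : inner_product U)
  (T : {linear V -> U}) (E : set V) x :
  bnd g gU T -> (forall y, E y -> T y = 0) -> adherent g E x -> T x = 0.
Proof.
move=> [M M0 hM] T0 xE; apply: (@nrm_eq0 _ _ gU).
apply/eqP; rewrite eq_le nrm_ge0 andbT.
apply: (@le_eps _ _ _ M) => e e0; rewrite add0r.
have [y Ey xy] := xE _ e0.
rewrite -[x](subrK y) linearD (T0 y)// addr0; apply: le_trans (hM _) _.
by rewrite mulrC ler_wpM2r// ltW.
Qed.

Lemma bnd_comp (U W : lmodType R[i]) (gU : inner_product U) (gW : inner_product W)
  (S : U -> V) (T : V -> W) : bnd gU g S -> bnd g gW T -> bnd gU gW (T \o S).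
Proof.
move=> [M M0 hM] [N N0 hN]; exists (N * M); first exact: mulr_ge0.
by move=> x /=; apply: le_trans (hN _) _; rewrite -mulrA ler_wpM2l.
Qed.

Lemma bnd_sub (U : lmodType R[i]) (gU : inner_product U) (S T : V -> U) :
  bnd g gU S -> bnd g gU T -> bnd g gU (fun x => S x - T x).
Proof.
move=> [M M0 hM] [N N0 hN]; exists (M + N); first exact: addr_ge0.
move=> x; apply: le_trans (nrmB _ _ _) _; rewrite mulrDl lerD//.
Qed.

Lemma bnd_id : bnd g g (@idfun V).
Proof. by exists 1 => // x; rewrite mul1r. Qed.

Lemma ker_closed (U : lmodType R[i]) (gU : inner_product U) (T : {linear V -> U}) :
  bnd g gU T -> closed_in g [set x | T x = 0].
Proof. by move=> bT x; apply: (adherent_ker bT). Qed.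

(** The closure of the range of a selfadjoint [Q] is orthogonal to its kernel. This makes solutions
    of [Q x = v] unique in that closure. *)
Lemma orth_injective Q x : adjoint_pair g g Q Q -> adherent g (range Q) x -> Q x = 0 -> x = 0.
Proof.
move=> sQ xQ Qx0; apply: (@nrm_eq0 _ _ g); apply/eqP; rewrite eq_le nrm_ge0 andbT.
apply: (@le_eps _ _ _ 1) => e e0; rewrite add0r mulr1.
have [_ [y _ <-] xy] := xQ _ e0; apply: le_trans (ltW xy).
have [->|x0] := eqVneq x 0; first by rewrite nrm0 nrm_ge0.
have Qyx : rip g (Q y) x = 0 by rewrite /rip sQ Qx0 linear0r.
have := rip_CS g (x - Q y) x; rewrite ripBl Qyx subr0 nrmE.
by rewrite expr2 ler_pM2r// nrm_gt0.
Qed.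

Section PartialIsometry.
Variables (a u A Q : {linear V -> V}).
Hypotheses (gC : seq_complete g) (sa : adjoint_pair g g a a).
Hypotheses (pd : polar_decomposition g a u A) (sq : positive_sqrt g A Q).

(* The adjoint [u'] satisfies [u A u' >= 0] and [(u A u')^2 = a a = A^2], so
   [u A u' = A] by uniqueness of the square root, and likewise for [Q]. *)
Lemma polar_commute :
  [/\ bnd g g u, forall x, a x = u (Q (Q x)), forall x, u (Q x) = Q (u x),
      forall x, adherent g (range Q) x -> u (u x) = x
    & forall x y, adherent g (range Q) y -> g (u x) y = g x (u y)].
Proof.
have [mod [/bounded_opP bu iso] aE kerE] := pd.
have [bA pA sA AA] := modulusP sa mod; have [bQ pQ sQ QQ] := positive_sqrtP sq.
have lk : submod_closed (mem [set x | u x = 0]).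
  split; first by apply/mem_set; rewrite /= linear0.
  move=> c x y /set_mem /= x0 /set_mem /= y0; apply/mem_set => /=.
  by rewrite linearP x0 y0 scaler0 addr0.
have perp x z : u z = 0 -> rip g (Q x) z = 0.
  move=> /kerE az; have Az : A (A z) = 0 by rewrite AA az linear0.
  have Qz : Q z = 0 by apply: (psd_ker sQ); rewrite QQ; exact: (psd_ker sA).
  by rewrite /rip sQ Qz linear0r.
have isoE x y : (forall z, u z = 0 -> rip g x z = 0) -> rip g (u x) (u y) = rip g x y.
  move=> xp.
  have niso w : (forall z, u z = 0 -> rip g w z = 0) -> rip g (u w) (u w) = rip g w w.
    move=> wp; rewrite !nrmE; congr (_ ^+ 2); apply: complexI.
    have := iso w; rewrite !ip_normE; apply => z uz.
    have Nz : lsubspace_set (Subspace lk) z by [].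
    by apply: (@herm_eq0 _ _ g w (Subspace lk)) => // z'; exact: wp.
  (* Only [x] is assumed orthogonal to the kernel of [u]. Removing from [y] its projection onto the
     kernel changes neither side, after which the isometry can be polarized. *)
  have [n un nP] := projection (N := Subspace lk) y gC (ker_closed bu).
  have yp z : u z = 0 -> rip g (y - n) z = 0 by move=> uz; rewrite /rip nP.
  have -> : u y = u (y - n) by rewrite linearB/= (un : u n = 0) subr0.
  have -> : rip g x y = rip g x (y - n) by rewrite ripBr (xp n un) subr0.
  move: (y - n) yp => v vp.
  have := niso (x + v); rewrite linearD !ripDl !ripDr (niso x)// (niso v)//.
  rewrite [rip g (u v) _]ripC [rip g v x]ripC => h.
  have /h : forall z, u z = 0 -> rip g (x + v) z = 0.
    by move=> z uz; rewrite ripDl xp// vp// addr0.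
  by move: (rip _ _ _) (rip _ _ _) (rip _ _ _) (rip _ _ _) => *; lra.
have [u' uu'] := adjoint_exists gC bu.
have bu' := bnd_adjoint bu uu'.
have uu'r x y : rip g (u x) y = rip g x (u' y) by rewrite /rip uu'.
have [sQr _] := pQ.
have u'uQ x : u' (u (Q x)) = Q x.
  apply: (@rip_inj _ _ g) => y; rewrite ripC -uu'r ripC isoE//; exact: perp.
have Qu'u x : Q (u' (u x)) = Q x.
  apply: (@rip_inj _ _ g) => z.
  rewrite sQr ripC -uu'r isoE; last exact: perp.
  by rewrite ripC -sQr.
have conj_sqrt B : psd g B -> bnd g g B -> psd g (u \o B \o u') /\ bnd g g (u \o B \o u').
  move=> [sB pB] bB; split; last by apply: bnd_comp bu' _; apply: bnd_comp.
  split=> [x y|x] /=; last by rewrite uu'r.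
  by rewrite uu'r sB ripC -uu'r ripC.
have uAu' x : u (A (u' x)) = A x.
  have [pB bB] := conj_sqrt _ pA bA.
  apply: (sqrt_unique bB bA pB pA) => {}x /=.
  have -> : u' (u (A (u' x))) = A (u' x) by rewrite -!QQ u'uQ.
  have aE' y : a y = A (u' y).
    apply: (@dot_injr _ _ g) => z; rewrite -sa aE -[RHS]sA uu' //.
  by rewrite AA -aE' -aE.
have QuQ x : u (Q (u' x)) = Q x.
  have [pB bB] := conj_sqrt _ pQ bQ.
  by apply: (sqrt_unique bB bQ pB pQ) => {}x /=; rewrite u'uQ !QQ uAu'.
have uQ x : u (Q x) = Q (u x) by rewrite -(Qu'u x) QuQ.
(* As [u] commutes with [A], [u u A^2 = a a = A^2], which is the claim under [Q^4]; three of the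
   factors [Q] are then stripped by [psd_ker]. *)
have uuQ x : u (u (Q x)) = Q x.
  have h : Q (Q (Q (Q (u (u x))))) = Q (Q (Q (Q x))).
    have uA y : u (A y) = A (u y) by rewrite -!QQ !uQ.
    by rewrite -!uQ !QQ (uA (A x)) -!aE -AA.
  rewrite !uQ; apply/eqP; rewrite -subr_eq0 -linearB; apply/eqP.
  do 3! apply: (psd_ker sQ).
  by rewrite !linearB /= h subrr.
split=> //.
- by move=> x; rewrite aE QQ.
- move=> x xQ; apply/eqP; rewrite -subr_eq0; apply/eqP.
  apply: (@adherent_ker _ g ((u \o u) \- idfun) (range Q)) => //.
    by apply: bnd_sub; [exact: bnd_comp|exact: bnd_id].
  by move=> _ [y _ <-] /=; rewrite uuQ subrr.
- move=> x y yQ; rewrite uu'; congr (g x _); apply/eqP; rewrite -subr_eq0; apply/eqP.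
  apply: (@adherent_ker _ g (u' \- u) (range Q)) => //; first exact: bnd_sub.
  by move=> _ [z _ <-] /=; rewrite -{1}(uuQ z) uQ u'uQ subrr.
Qed.

End PartialIsometry.
End Polar.

(** * Completeness and equivalent norms *)

Section Packing.
Context (R : realType) (V : lmodType R[i]).

Lemma hermitian_pack (h : V -> V -> R[i]) :
  (forall a x y z, h (a *: x + y) z = a * h x z + h y z) ->
  (forall x y, h x y = conjC (h y x)) ->
  exists f : hermitian_form V, forall x y, f x y = h x y.
Proof.
move=> hl hs.
have hr a x y z : h z (a *: x + y) = conjC a * h z x + h z y.
  by rewrite hs hl rmorphD rmorphM /= -!hs.
have zl y : zmod_morphism (h^~ y).
  by move=> x x'; have := hl (-1) x' x y; rewrite scaleN1r mulN1r addrC => ->; rewrite addrC.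
have zr x : zmod_morphism (h x).
  move=> y y'; have := hr (-1) y' y x; rewrite scaleN1r rmorphN1 mulN1r addrC => ->.
  by rewrite addrC.
have h0l y : h 0 y = 0 by have := zl y 0 0; rewrite subrr => ->; rewrite subrr.
have h0r y : h y 0 = 0 by have := zr y 0 0; rewrite subrr => ->; rewrite subrr.
have sl y : scalable_for *%R (h^~ y).
  by move=> a x; have := hl a x 0 y; rewrite !addr0 h0l addr0.
have sr x : scalable_for (conjC \; *%R) (h x).
  by move=> a y; have := hr a y 0 x; rewrite !addr0 h0r addr0.
have hs' x y : h x y = (-1) ^+ false * conjC (h y x) by rewrite expr0 mul1r.
pose B := isBilinear.Build R[i] V V R[i] *%R (conjC \; *%R) h zl zr sl sr.
pose b : {bilinear V -> V -> R[i] | *%R & (conjC \; *%R)} := HB.pack h B.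
pose f : hermitian_form V :=
  HB.pack h B (isHermitianSesquilinear.Build R[i] V false conjC b hs').
by exists f.
Qed.

Lemma inner_pack (f : hermitian_form V) : (forall x, x != 0 -> 0 < f x x) ->
  exists g : inner_product V, forall x y, g x y = f x y.
Proof.
move=> pos.
pose g : inner_product V := HB.pack (f : V -> V -> R[i]) (Hermitian.class f) (isDotProduct.Build R[i] V f pos).
by exists g.
Qed.

(** Equality of the packed structures, not only of their values, allows an inner product to be
    rewritten inside predicates and types that depend on it. *)
Lemma inner_product_ext (g1 g2 : inner_product V) :
  (forall x y, g1 x y = g2 x y) -> g1 = g2.
Proof.
move=> e.
have {e} : Dot.sort g1 = Dot.sort g2 by apply/funext => x; apply/funext => y; exact: e.
case: g1 g2 => [s1 [[p1] [a1 b1 c1 d1] [h1]]] [s2 [[p2] [a2 b2 c2 d2] [h2]]] /= e.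
case: s2 / e p2 a2 b2 c2 d2 h2 => p2 a2 b2 c2 d2 h2.
by rewrite (Prop_irrelevance p1 p2) (Prop_irrelevance a1 a2) (Prop_irrelevance b1 b2)
  (Prop_irrelevance c1 c2) (Prop_irrelevance d1 d2) (Prop_irrelevance h1 h2).
Qed.

End Packing.

Section Hilbert.
Context (R : realType) (V : lmodType R[i]).
Implicit Types g : inner_product V.

Lemma complete_equiv g1 g2 : bnd g1 g2 idfun -> bnd g2 g1 idfun ->
  seq_complete g1 -> seq_complete g2.
Proof.
move=> [M1 M10 h12] [M2 M20 h21] c1 u uc.
have M2p : 0 < M2 + 1 by rewrite ltr_wpDl.
have M1p : 0 < M1 + 1 by rewrite ltr_wpDl.
have [e e0|l ul] := c1 u.
  have [N hN] := uc _ (divr_gt0 e0 M2p); exists N => m n Nm Nn.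
  have := hN m n Nm Nn; rewrite ltr_pdivlMr//; have := h21 (u m - u n).
  have := nrm_ge0 g2 (u m - u n); rewrite /=.
  by move: (nrm _ _) (nrm _ _) => a b *; nra.
exists l => e e0; have [N hN] := ul _ (divr_gt0 e0 M1p); exists N => n Nn.
have := hN n Nn; rewrite ltr_pdivlMr//; have := h12 (u n - l).
have := nrm_ge0 g1 (u n - l); rewrite /=.
by move: (nrm _ _) (nrm _ _) => a b *; nra.
Qed.

Lemma adherent_equiv g1 g2 (E : set V) x : bnd g1 g2 idfun ->
  adherent g1 E x -> adherent g2 E x.
Proof.
move=> [M M0 hM] xE e e0; have Mp : 0 < M + 1 by rewrite ltr_wpDl.
have [y Ey] := xE _ (divr_gt0 e0 Mp); rewrite ltr_pdivlMr// => xy; exists y => //.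
have := hM (x - y); have := nrm_ge0 g1 (x - y); rewrite /=.
by move: xy; move: (nrm _ _) (nrm _ _) => a b *; nra.
Qed.

Lemma separable_equiv g1 g2 : bnd g1 g2 idfun -> separable g1 -> separable g2.
Proof. by move=> b [D cD dD]; exists D => // x; exact: (adherent_equiv b). Qed.

Lemma subspace_complete g (N : lsubspace V) : closed_in g (lsubspace_set N) ->
  seq_complete g -> seq_complete (restr g N).
Proof.
move=> cN gC u uc; have [e e0|l ul] := gC (fun n => val (u n)).
  by have [n hn] := uc _ e0; exists n.
have Nl : lsubspace_set N l.
  apply: cN => e /ul[n hn]; exists (val (u n)); first exact: valN.
  by rewrite nrmBC; apply: hn.
exists (SubspaceElt (mem_set Nl : l \in lsubspace_pred N)) => e /ul[n hn].
by exists n.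
Qed.

(** Projecting a countable dense set onto [N] brings none of its points further away from a point of
    [N]. *)
Lemma subspace_separable g (N : lsubspace V) : closed_in g (lsubspace_set N) ->
  seq_complete g -> separable g -> separable (restr g N).
Proof.
move=> cN gC [D cD dD].
have /choice[P PP] : forall x, exists n : N, forall n' : N, g (x - val n) (val n') = 0.
  move=> x; have [n Nn nP] := projection x gC cN.
  exists (SubspaceElt (mem_set Nn : n \in lsubspace_pred N)) => n'; exact/nP/valN.
exists (P @` D); first exact: sub_countable (card_image_le _ _) cD.
move=> n e e0; have [d Dd nd] := dD (val n) _ e0; exists (P d); first by exists d.
apply: le_lt_trans nd; have [n0|n0] := eqVneq (n - P d) 0; first by rewrite n0 nrm0 nrm_ge0.
rewrite -(ler_pM2r (nrm_gt0 (restr g N) n0)) -expr2 -nrmE.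
apply: le_trans (rip_CS g (val n - d) (val (n - P d))).
rewrite -[leRHS]addr0 -[X in _ <= _ + X](_ : rip g (d - val (P d)) (val (n - P d)) = 0).
  change (rip (restr g N) _ _) with (rip g (val (n - P d)) (val (n - P d))).
  by rewrite -ripDl subrKA raddfB.
by rewrite /rip PP.
Qed.

(** The supremum defining the norm is nearly attained at [y = x], hence at points of [E] close to
    [x]. *)
Lemma adherent_dual g (E : set V) x (M : R) : 0 <= M -> adherent g E x ->
  (forall y, E y -> rip g x y <= M * nrm g y) -> nrm g x <= M.
Proof.
move=> M0 xE h; have [->|x0] := eqVneq x 0; first by rewrite nrm0.
rewrite -(ler_pM2r (nrm_gt0 g x0)) -expr2 -nrmE.
apply: (@le_eps _ _ _ (nrm g x + M)) => e e0.
have [y Ey xy] := xE _ e0; have := h y Ey; have := rip_CS g x (x - y).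
have := nrm_sub g y x 0; rewrite !subr0 (nrmBC g y) ripBr.
have := nrm_ge0 g x; move: xy.
by move: (nrm _ _) (nrm _ _) (nrm _ _) (rip _ _ _) (rip _ _ _) => *; nra.
Qed.

(* Banach's inverse theorem for the identity map, without open mappings: the
   functionals [g1 _ z] with [g2]-dual norm at most 1 are pointwise bounded. *)
Lemma bounded_inverse g1 g2 : seq_complete g1 -> seq_complete g2 ->
  bnd g2 g1 idfun -> bnd g1 g2 idfun.
Proof.
move=> c1 c2 [C C0 hC].
have [|||T TP] := @form_representation R V V g2 g1 c2.
- by move=> u a x y; rewrite linearPl.
- by move=> x a u v; rewrite linearPr.
- move=> u; exists (C * nrm g1 u) => x; apply: le_trans (rip_CS g1 _ _) _.
  by rewrite mulrAC ler_wpM2r ?nrm_ge0//; exact: hC.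
have [x|M M0 hM] := weakly_bounded (Z := [set z | nrm g2 (T z) <= 1]) c1.
  exists (nrm g2 x) => z /= Tz1; rewrite /rip TP.
  by apply: le_trans (rip_CS_abs g2 _ _) _; rewrite ler_piMr ?nrm_ge0.
have T0 z : T z = 0 -> z = 0.
  by move=> Tz; apply: (@dot_injr _ _ g1) => x; rewrite TP Tz !linear0r.
have hM' z : nrm g1 z <= M * nrm g2 (T z).
  have [->|z0] := eqVneq z 0; first by rewrite nrm0 mulr_ge0 ?nrm_ge0.
  have Tz : 0 < nrm g2 (T z) by apply: nrm_gt0; apply: contraNneq z0 => /T0 ->.
  have := hM ((nrm g2 (T z))^-1%:C *: z).
  rewrite /= linearZ /= !nrmZ ger0_norm ?invr_ge0 ?(ltW Tz)// mulVf ?lexx ?lt0r_neq0//.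
  by move=> /(_ isT); rewrite mulrC ler_pdivrMr.
exists M => // x /=.
have lp : linear (fun z => g1 z x : R[i]^o) by move=> a y z; rewrite linearPl.
(* Riesz along [T] shows that [x] adheres to the range of [T], so that its [g2]-norm can be tested
   on vectors [T z], where [g2 x (T z) = g1 x z]. *)
have [z|xi rxi xiP] := @riesz_range R V V g2 T (linear_of lp) (M * nrm g1 x) c2.
  apply: le_trans (rip_CS g1 z x) _; rewrite mulrAC ler_wpM2r ?nrm_ge0//.
have -> : x = xi.
  apply: (@dot_injr _ _ g1) => z; rewrite -[LHS]/(linear_of lp z) xiP.
  by rewrite herm_sym [RHS]herm_sym /= TP.
apply: (adherent_dual _ rxi); first by rewrite mulr_ge0 ?nrm_ge0.
move=> _ [z _ <-]; rewrite /rip -TP; apply: le_trans (rip_CS g1 _ _) _.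
rewrite mulrAC mulrC ler_wpM2r ?nrm_ge0//; exact: hM'.
Qed.

End Hilbert.

(** * Signatures and their extensions *)

Section Signature.
Context (R : realType) (V : lmodType R[i]).
Implicit Types (f : hermitian_form V) (g : inner_product V) (J : {linear V -> V}).

(** Operator identities in place of a fundamental decomposition. [signature_is] and [signature_of]
    pass between the two; the decomposition is recovered as the eigenspaces of [J] for [1] and
    [-1]. *)
Definition is_signature f (J : V -> V) g :=
  [/\ forall x y, g x y = f (J x) y, forall x, J (J x) = x,
      seq_complete g & separable g].

Lemma is_signature_sym f J g : is_signature f J g ->
  forall x y, f (J x) y = f x (J y).
Proof. by move=> [gE _ _ _] x y; rewrite -gE (herm_sym g) /= gE [RHS]herm_sym. Qed.

Lemma is_signature_form f J g : is_signature f J g -> forall x y, f x y = g (J x) y.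
Proof. by move=> [gE JJ _ _] x y; rewrite gE JJ. Qed.

Lemma is_signature_iso f J g : is_signature f J g -> forall x, nrm g (J x) = nrm g x.
Proof.
move=> sJ x; have [gE JJ _ _] := sJ.
by rewrite /nrm /rip !gE JJ -(is_signature_sym sJ).
Qed.

Lemma is_signature_bound f J g : is_signature f J g ->
  forall x y, `|rip f x y| <= nrm g x * nrm g y.
Proof.
move=> sJ x y; have -> : rip f x y = rip g (J x) y by rewrite /rip (is_signature_form sJ).
by apply: le_trans (rip_CS_abs _ _ _) _; rewrite (is_signature_iso sJ).
Qed.

Lemma signature_is (f : hermitian_form V) (J : signature f) : is_signature f J (ip J).
Proof.
have [Vp [Vm [[[sum _] orth]]]] := signatureP J.
move=> /hilbert_spaceP[gp [gpE gpC [Dp cDp dDp]]].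
move=> /hilbert_spaceP[gm [gmE gmC [Dm cDm dDm]]] JE.
have Jm (y : Vm) : J (val y) = - val y by have := JE 0 y; rewrite raddf0 !add0r.
have orth' (x : Vp) (y : Vm) : f (val y) (val x) = 0 by rewrite herm_sym orth conjC0.
have nE (x : Vp) (y : Vm) :
    nrm (ip J) (val x + val y) ^+ 2 = nrm gp x ^+ 2 + nrm gm y ^+ 2.
  have -> : nrm (ip J) (val x + val y) ^+ 2 = rip f (J (val x + val y)) (val x + val y).
    by rewrite -nrmE.
  rewrite -!nrmE JE /rip -gpE -gmE /restr linearBl !raddfD /= orth orth'.
  by rewrite oppr0 raddf0 addr0 add0r.
have np (x : Vp) (y : Vm) : nrm gp x <= nrm (ip J) (val x + val y).
  by rewrite -(@ler_pXn2r _ 2) ?nnegrE ?nrm_ge0// nE lerDl sqr_ge0.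
have nm (x : Vp) (y : Vm) : nrm gm y <= nrm (ip J) (val x + val y).
  by rewrite -(@ler_pXn2r _ 2) ?nnegrE ?nrm_ge0// nE lerDr sqr_ge0.
have nadd (x : Vp) (y : Vm) : nrm (ip J) (val x + val y) <= nrm gp x + nrm gm y.
  rewrite -(@ler_pXn2r _ 2) ?nnegrE ?addr_ge0 ?nrm_ge0// nE.
  have := nrm_ge0 gp x; have := nrm_ge0 gm y; move: (nrm _ _) (nrm _ _) => *; nra.
split=> // [x||].
- have [xp [xm ->]] := sum x.
  by rewrite JE linearB /= Jm; have := JE xp 0; rewrite raddf0 !addr0 subr0 opprK => ->.
- move=> u uc; have /choice[p pP] : forall n, exists p : Vp * Vm, u n = val p.1 + val p.2.
    by move=> n; have [a [b ab]] := sum (u n); exists (a, b).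
  have uE m n : u m - u n = val ((p m).1 - (p n).1) + val ((p m).2 - (p n).2).
    by rewrite !pP !raddfB /= opprD addrACA.
  have [e /uc[N hN]|lp hp] := gpC (fun n => (p n).1).
    exists N => m n Nm Nn; have := hN m n Nm Nn; rewrite uE; exact/le_lt_trans/np.
  have [e /uc[N hN]|lm hm] := gmC (fun n => (p n).2).
    exists N => m n Nm Nn; have := hN m n Nm Nn; rewrite uE; exact/le_lt_trans/nm.
  exists (val lp + val lm) => e e0; have e2 : 0 < e / 2 by rewrite divr_gt0.
  have [N1 h1] := hp _ e2; have [N2 h2] := hm _ e2; exists (maxn N1 N2) => n.
  rewrite geq_max => /andP[n1 n2].
  have -> : u n - (val lp + val lm) = val ((p n).1 - lp) + val ((p n).2 - lm).
    by rewrite !pP !raddfB /= opprD addrACA.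
  by apply: le_lt_trans (nadd _ _) _; rewrite [e]splitr ltrD ?h1 ?h2.
- exists ((fun p : Vp * Vm => val p.1 + val p.2) @` (Dp `*` Dm)).
    by apply: sub_countable (card_image_le _ _) _; exact: countableX.
  move=> x e e0; have e2 : 0 < e / 2 by rewrite divr_gt0.
  have [a [b ->]] := sum x; have [a' Da aa] := dDp a _ e2; have [b' Db bb] := dDm b _ e2.
  exists (val a' + val b'); first by exists (a', b').
  have -> : val a + val b - (val a' + val b') = val (a - a') + val (b - b').
    by rewrite !raddfB /= opprD addrACA.
  by apply: le_lt_trans (nadd _ _) _; rewrite [e]splitr ltrD.
Qed.

Lemma signature_of f J g : is_signature f J g ->
  exists J' : signature f, (forall x, J' x = J x) /\ @eq (inner_product V) (ip J') g.
Proof.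
move=> sJ; have [gE JJ gC gS] := sJ; have iso := is_signature_iso sJ.
have bJ : bnd g g J by exists 1 => // x; rewrite mul1r iso.
have eig (c : R[i]) : submod_closed (mem [set x | J x = c *: x]).
  split; first by apply/mem_set; rewrite /= linear0 scaler0.
  move=> a x y /set_mem /= xc /set_mem /= yc; apply/mem_set => /=.
  by rewrite linearP /= xc yc scalerDr !scalerA [a * c]mulrC.
pose E c := Subspace (eig c).
have Ecl c : closed_in g (lsubspace_set (E c)).
  move=> x xE /=; apply/eqP; rewrite -subr_eq0; apply/eqP.
  apply: (@adherent_ker _ _ g _ g (J \- (c \*: idfun)) (lsubspace_set (E c))) => //.
    apply: bnd_sub => //; exists `|complex.Re `|c| |.
      exact: normr_ge0.
    move=> y /=; rewrite -[leLHS]/(complex.Re ((nrm g (c *: y))%:C)) -ip_normE.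
    rewrite (normrZ c (y : ip_space g)) ip_normE.
    by rewrite mulrC Re_realM mulrC ler_wpM2r ?nrm_ge0// ler_norm.
  by move=> y /= ->; rewrite subrr.
have EJ c (x : E c) : J (val x) = c *: val x by have := valN x.
have EH c : (hilbert_space (restr g (E c))).
  apply/hilbert_spaceP; exists (restr g (E c)); split=> //.
    exact: subspace_complete.
  exact: subspace_separable.
have fd : fundamental_decomposition f (E 1) (E (-1)).
  split.
  - split=> [x|].
      have px : J (2^-1 *: (x + J x)) = 1 *: (2^-1 *: (x + J x)).
        by rewrite scale1r linearZ linearD /= JJ addrC.
      have mx : J (2^-1 *: (x - J x)) = -1 *: (2^-1 *: (x - J x)).
        by rewrite scaleN1r linearZ linearB /= JJ -scalerN opprB.
      exists (SubspaceElt (mem_set px : _ \in lsubspace_pred (E 1))).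
      exists (SubspaceElt (mem_set mx : _ \in lsubspace_pred (E (-1)))) => /=.
      rewrite -scalerDr addrACA subrr addr0 -mulr2n -[x *+ 2]scaler_nat scalerA mulVf ?scale1r//.
    apply/seteqP; split=> [x /= [x1 x2]|_ ->]; last by split; exact: subspace0.
    apply/eqP; have := x1; rewrite x2 scale1r scaleN1r => /eqP; rewrite eq_sym -subr_eq0 opprK.
    by rewrite -mulr2n -[x *+ 2]scaler_nat scaler_eq0 pnatr_eq0.
  - move=> x y; have := is_signature_sym sJ (val x) (val y).
    rewrite !EJ scale1r scaleN1r linearNr => /eqP; rewrite -subr_eq0 opprK -mulr2n.
    by rewrite mulrn_eq0 /= => /eqP.
  - have [h [hE hC hS]] := EH 1; exists h; split=> // x y.
    by rewrite -hE /restr gE EJ scale1r.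
  - have [h [hE hC hS]] := EH (-1); exists h; split=> // x y.
    by rewrite -hE /restr gE EJ scaleN1r linearNl.
have JP : exists Vp Vm : lsubspace V, fundamental_decomposition f Vp Vm /\
    forall (x : Vp) (y : Vm), J (val x + val y) = val x - val y.
  by exists (E 1), (E (-1)); split=> // x y; rewrite linearD /= !EJ scale1r scaleN1r.
exists (Signature JP); split=> //.
by apply: inner_product_ext => x y; rewrite gE.
Qed.

End Signature.

Section NormEquivalence.
Context (R : realType) (V : lmodType R[i]).
Implicit Types (f : hermitian_form V) (g h : inner_product V) (J P : {linear V -> V}).

Lemma nrm_scale_bound g1 g2 (M : R) x :
  (forall y, nrm g2 y <= 1 -> nrm g1 y <= M) -> nrm g1 x <= M * nrm g2 x.
Proof.
move=> hM; have [->|x0] := eqVneq x 0; first by rewrite !nrm0 mulr0.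
have xp := nrm_gt0 g2 x0; have := hM ((nrm g2 x)^-1%:C *: x).
rewrite !nrmZ ger0_norm ?invr_ge0 ?(ltW xp)// mulVf ?lexx ?lt0r_neq0//.
by move=> /(_ isT); rewrite mulrC ler_pdivrMr.
Qed.

(* Uniform boundedness on the functionals [f _ y], [|y|_2 <= 1]. *)
Lemma signature_norm_le f J g1 g2 : is_signature f J g1 ->
  (forall x y, `|rip f x y| <= nrm g2 x * nrm g2 y) -> bnd g2 g1 idfun.
Proof.
move=> sJ fb; have [gE JJ gC _] := sJ; have iso := is_signature_iso sJ.
have [x|M M0 hM] := weakly_bounded (Z := [set z | exists2 y, nrm g2 y <= 1 & z = J y]) gC.
  exists (nrm g2 x) => _ [y y1 ->].
  have -> : rip g1 x (J y) = rip f x y by rewrite /rip gE (is_signature_sym sJ) JJ.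
  by apply: le_trans (fb _ _) _; rewrite ler_piMr ?nrm_ge0.
exists M => // x /=; apply: nrm_scale_bound => y y1.
by rewrite -iso; apply: hM; exists y.
Qed.

Lemma closed_equiv g1 g2 (E : set V) : bnd g2 g1 idfun ->
  closed_in g1 E -> closed_in g2 E.
Proof. by move=> b cE x /(adherent_equiv b)/cE. Qed.

Lemma bnd_idP g1 g2 (M : R) : (forall x, nrm g2 x <= M * nrm g1 x) -> bnd g1 g2 idfun.
Proof.
move=> h; exists `|M| => // x /=; apply: le_trans (h x) _.
by rewrite ler_wpM2r ?nrm_ge0// ler_norm.
Qed.

End NormEquivalence.

(** * Enlarging uniformly definite subspaces *)

Section Extension.
Context (R : realType) (V : lmodType R[i]).
Implicit Types (f : hermitian_form V) (g h : inner_product V) (J P : {linear V -> V}).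

(** Coercivity makes [f] an inner product on [N] whose norm is equivalent to that of [h], so [N] is
    complete for it, and Riesz in [N] represents [f _ v] even though [f] may be indefinite on
    [V]. *)
Lemma coercive_projection f h (N : lsubspace V) (c : R) : seq_complete h ->
  closed_in h (lsubspace_set N) ->
  (forall x y, `|rip f x y| <= nrm h x * nrm h y) -> 0 < c ->
  (forall n, lsubspace_set N n -> c * nrm h n ^+ 2 <= rip f n n) ->
  exists P : {linear V -> V}, [/\ forall v, lsubspace_set N (P v),
    forall v n, lsubspace_set N n -> f (v - P v) n = 0 & bnd h h P].
Proof.
move=> hC Ncl fb c0 fc.
have freal x : complex.Im (f x x) = 0.
  by have := herm_sym f x x; case: (f x x) => a b [] /= /eqP; rewrite -subr_eq0 opprK -mulr2n mulrn_eq0 => /eqP.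
have fpos (x : N) : x != 0 -> 0 < restr f N x x.
  move=> x0; rewrite /restr ltcE freal /= eqxx /= -/(rip f _ _).
  apply: lt_le_trans (fc _ (valN x)); rewrite mulr_gt0// exprn_gt0//.
  by rewrite nrm_gt0//; apply: contraNneq x0 => x0; apply/eqP/val_inj; rewrite x0 raddf0.
have [gN gNE] := inner_pack fpos.
have nN (x : N) : nrm gN x ^+ 2 = rip f (val x) (val x) by rewrite -nrmE /rip gNE.
have b1 : bnd (restr h N) gN idfun.
  apply: (@bnd_idP _ _ _ _ 1) => x; rewrite mul1r.
  rewrite -(@ler_pXn2r _ 2) ?nnegrE ?nrm_ge0// nN.
  by apply: le_trans (ler_norm _) _; rewrite expr2; exact: fb.
have b2 : bnd gN (restr h N) idfun.
  apply: (@bnd_idP _ _ _ _ (Num.sqrt c^-1)) => x.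
  rewrite -(@ler_pXn2r _ 2) ?nnegrE ?mulr_ge0 ?nrm_ge0 ?sqrtr_ge0//.
  have s2 : Num.sqrt c^-1 ^+ 2 = c^-1 by rewrite sqr_sqrtr// invr_ge0 ltW.
  rewrite exprMn s2 nN mulrC ler_pdivlMr// mulrC.
  exact: (fc _ (valN x)).
have gC := complete_equiv b1 b2 (subspace_complete Ncl hC).
have [K K0 hK] := b2.
have [|||P0 PP] := @form_representation R V N gN (fun n v => f (val n) v) gC.
- by move=> v a x y; rewrite linearPl.
- by move=> n a u v; rewrite linearPr.
- move=> v; exists (nrm h v * K) => n; apply: le_trans (ler_norm _) _.
  apply: le_trans (fb _ _) _; rewrite mulrC -mulrA ler_wpM2l ?nrm_ge0//; exact: hK.
have lP : linear (fun v => val (P0 v)) by move=> a x y; rewrite !linearP.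
exists (linear_of lP); split=> [v|v n Nn|]; first exact: valN.
  have e := PP (SubspaceElt (mem_set Nn : n \in lsubspace_pred N)) v.
  rewrite gNE /restr /= in e.
  by rewrite herm_sym /= linearBr /= e subrr conjC0.
exists (K * K); first exact: mulr_ge0.
move=> v; have [Pv|Pv] := eqVneq (P0 v) 0.
  by rewrite /= Pv nrm0 !mulr_ge0 ?nrm_ge0.
have hv := hK (P0 v); apply: le_trans hv _; rewrite -mulrA ler_wpM2l//.
rewrite -(ler_pM2r (nrm_gt0 gN Pv)) -expr2 -nrmE /rip -PP -/(rip f _ _).
apply: le_trans (ler_norm _) _; apply: le_trans (fb _ _) _.
by rewrite mulrC [leRHS]mulrAC [leRHS]mulrC ler_wpM2l ?nrm_ge0//; exact: hK.
Qed.

(** The reflection [J' = 2 P - 1] works because [f (J' x) x = f (P x) (P x) - f z z] with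
    [z = x - P x]. Strict negativity on the complement, without a uniform constant, suffices:
    boundedness of [P] bounds the new norm by that of [h], and [signature_norm_le] gives the
    converse. *)
Lemma projection_signature f J h P (N : lsubspace V) (c : R) : is_signature f J h ->
  (forall v, lsubspace_set N (P v)) ->
  (forall v n, lsubspace_set N n -> f (v - P v) n = 0) -> bnd h h P -> 0 < c ->
  (forall n, lsubspace_set N n -> c * nrm h n ^+ 2 <= rip f n n) ->
  (forall z, (forall n, lsubspace_set N n -> f z n = 0) -> z != 0 -> rip f z z < 0) ->
  exists J' h', [/\ is_signature f J' h', forall x, J' x = P x - (x - P x),
    forall n, lsubspace_set N n -> J' n = n
    & forall z, (forall n, lsubspace_set N n -> f z n = 0) -> J' z = - z].
Proof.
move=> sJ PN Po bP c0 fc fneg; have fb := is_signature_bound sJ.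
have [hE JJ hC hS] := sJ.
have n0 x : nrm h x ^+ 2 <= 0 -> x = 0.
  by rewrite le_eqVlt ltNge sqr_ge0 orbF sqrf_eq0 => /eqP /nrm_eq0.
have Pid n : lsubspace_set N n -> P n = n.
  move=> Nn; apply/eqP; rewrite eq_sym -subr_eq0; apply/eqP/n0.
  have Nd : lsubspace_set N (n - P n) by exact: subspaceB.
  by have := fc _ Nd; rewrite /rip Po//= pmulr_rle0.
have Pz z : (forall n, lsubspace_set N n -> f z n = 0) -> P z = 0.
  move=> zN; apply: n0.
  have : rip f (P z) (P z) = 0.
    have := Po z _ (PN z); rewrite linearBl /= (zN _ (PN z)) sub0r => /eqP.
    by rewrite oppr_eq0 /rip => /eqP ->.
  by have := fc _ (PN z) => h1 h2; move: h1; rewrite h2 pmulr_rle0.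
have PE x y : f (P x) y = f (P x) (P y).
  have e : f (P x) (y - P y) = 0 by rewrite herm_sym Po ?conjC0//; exact: PN.
  by rewrite -{1}(subrK (P y) y) linearDr /= e add0r.
have Psym x y : f (P x) y = f x (P y).
  by rewrite PE (herm_sym f (P x)) -PE -herm_sym.
pose J' := (P \- (idfun \- P)) : {linear V -> V}.
have J'E x : J' x = P x - (x - P x) by [].
have fJ' x y : f (J' x) y = conjC (f (J' y) x).
  by rewrite !J'E !linearBl /= !rmorphB /= -!herm_sym Psym.
have fJ'l a x y z : f (J' (a *: x + y)) z = a * f (J' x) z + f (J' y) z.
  by rewrite linearP linearPl.
have [h0 h0E] := @hermitian_pack R V (fun x y => f (J' x) y) fJ'l fJ'.
have split_pos (x : V) : x != 0 -> 0 < rip f (J' x) x.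
  move=> x0; set z := x - P x.
  have zN n : lsubspace_set N n -> f z n = 0 by exact: Po.
  have -> : rip f (J' x) x = rip f (P x) (P x) - rip f z z.
    have e0 : rip f z (P x) = 0 by rewrite /rip zN//.
    have xz : x = P x + z by rewrite /z addrC subrK.
    rewrite {2}xz J'E -/z; clearbody z.
    by rewrite ripBl !ripDr e0 [rip f (P x) z]ripC e0 addr0 add0r.
  have := fc _ (PN x) => h1.
  have [Px|Px] := eqVneq (P x) 0.
    have z0 : z != 0 by rewrite /z Px subr0.
    by rewrite Px rip0l sub0r oppr_gt0 fneg.
  have p1 : 0 < rip f (P x) (P x).
    by apply: lt_le_trans h1; rewrite mulr_gt0// exprn_gt0// nrm_gt0.
  have [->|z0] := eqVneq z 0; first by rewrite rip0l subr0.
  by have := fneg _ zN z0; lra.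
have h0pos (x : V) : x != 0 -> 0 < h0 x x.
  move=> x0; have := herm_sym h0 x x; rewrite !h0E.
  have := split_pos x x0; rewrite /rip; case: (f _ _) => a b /= a0 [] /eqP.
  by rewrite -subr_eq0 opprK -mulr2n mulrn_eq0 /= => /eqP ->; rewrite ltcE /= eqxx.
have [h' h'E] := inner_pack h0pos.
have J'J' x : J' (J' x) = x.
  have Pw : P (J' x) = P x 
    by rewrite J'E (raddfB P (P x)) (raddfB P x) /= (Pid _ (PN x)) subKr.
  by rewrite J'E Pw J'E addrAC subrr add0r opprK addrC subrK.
have h'f x y : h' x y = f (J' x) y by rewrite h'E h0E.
have J'sym x y : f (J' x) y = f x (J' y) by rewrite fJ' -herm_sym.
have niso x : nrm h' (J' x) = nrm h' x by rewrite /nrm /rip !h'f J'J' -J'sym.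
have b1 : bnd h' h idfun.
  apply: (signature_norm_le sJ) => x y.
  have -> : rip f x y = rip h' (J' x) y by rewrite /rip h'f J'J'.
  by apply: le_trans (rip_CS_abs _ _ _) _; rewrite niso.
have bJ' : bnd h h J' by do 2! apply: bnd_sub => //; exact: bnd_id.
have b2 : bnd h h' idfun.
  have [M M0 hM] := bJ'; apply: (@bnd_idP _ _ _ _ (Num.sqrt M)) => x.
  rewrite -(@ler_pXn2r _ 2) ?nnegrE ?mulr_ge0 ?nrm_ge0 ?sqrtr_ge0//.
  have s2 : Num.sqrt M ^+ 2 = M by rewrite sqr_sqrtr.
  rewrite exprMn s2 -nrmE /rip h'f -/(rip f _ _).
  apply: le_trans (ler_norm _) _; apply: le_trans (fb _ _) _.
  by rewrite expr2 mulrA ler_wpM2r ?nrm_ge0.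
exists J', h'; split=> //.
- split=> //; [exact: complete_equiv b2 b1 hC|exact: separable_equiv b2 hS].
- by move=> n Nn; rewrite J'E Pid// subrr subr0.
- by move=> z zN; rewrite J'E Pz// subr0 sub0r.
Qed.

End Extension.

Section Extend.
Context (R : realType) (V : lmodType R[i]).
Implicit Types (f : hermitian_form V) (g h : inner_product V) (J P : {linear V -> V}).

Lemma rip_orthD h x y : rip h x y = 0 -> nrm h (x + y) ^+ 2 = nrm h x ^+ 2 + nrm h y ^+ 2.
Proof. by move=> xy; rewrite -!nrmE ripDl !ripDr [rip h y x]ripC xy; ring. Qed.

Lemma orth_adherent f J h (E : set V) x : is_signature f J h -> adherent h E x ->
  forall y, (forall z, E z -> rip f z y = 0) -> rip f x y = 0.
Proof.
move=> sJ xE y Ey; apply/eqP; rewrite -normr_eq0 eq_le normr_ge0 andbT.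
apply: (@le_eps _ _ _ (nrm h y)) => e e0; rewrite add0r.
have [z Ez xz] := xE _ e0; have := is_signature_bound sJ (x - z) y.
rewrite ripBl (Ey _ Ez) subr0 => /le_trans; apply.
by rewrite ler_wpM2r ?nrm_ge0// ltW.
Qed.

(* [Q n = n + J n] is twice the positive component of [n].  The positive
   component of [z] lies in the closure of the positive components of [N], where
   it is dominated by the negative one. *)
Lemma uniformly_positive_neg f J h (N : lsubspace V) (c : R) : is_signature f J h ->
  0 < c -> c <= 1 -> (forall n, lsubspace_set N n -> c * nrm h n ^+ 2 <= rip f n n) ->
  forall z, (forall n, lsubspace_set N n -> f z n = 0) ->
    (forall e, J e = e -> (forall n, lsubspace_set N n -> f e n = 0) -> f z e = 0) ->
    z != 0 -> rip f z z < 0.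
Proof.
move=> sJ c0 c1 fc z zN zE z0; have [hE JJ hC _] := sJ; have iso := is_signature_iso sJ.
have fh x y : rip f x y = rip h (J x) y by rewrite /rip hE JJ.
have hJ x y : rip h (J x) y = rip h x (J y).
  by rewrite /rip !hE JJ (is_signature_sym sJ) JJ.
pose p := z + J z; pose m := z - J z.
have diff x y : rip h (x + J x) (y + J y) - rip h (x - J x) (y - J y) = 4 * rip f x y.
  rewrite !ripDl !ripDr !ripNl !ripNr fh hJ -[rip h (J x) (J y)]hJ JJ -hJ; lra.
have lQ : linear (fun n : N => val n + J (val n)).
  by move=> a x y /=; rewrite !linearP scalerDr addrACA.
have lp : linear (fun n : N => h (val n + J (val n)) p : R[i]^o).
  by move=> a x y; rewrite lQ linearPl.
have [n|xi xiQ xiP] := @riesz_range R N V h (linear_of lQ) (linear_of lp) (nrm h p) hC.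
  by rewrite mulrC; exact: rip_CS.
have Jxi : J xi = xi.
  apply/eqP; rewrite -subr_eq0; apply/eqP.
  apply: (@adherent_ker _ _ h _ h (J \- idfun) _ _ _ _ xiQ).
    apply: bnd_sub; last exact: bnd_id.
    by exists 1 => // x; rewrite mul1r iso.
  by move=> _ [n _ <-] /=; rewrite linearD /= JJ [J _ + _]addrC subrr.
have Jp : J p = p by rewrite /p linearD /= JJ addrC.
(* [e] is fixed by [J] and orthogonal to [N], so [zE] applies to it and forces [p = xi]. *)
pose e := p - xi.
have Je : J e = e by rewrite /e linearB /= Jp Jxi.
have eQ n : lsubspace_set N n -> rip h (n + J n) e = 0.
  move=> Nn; have := xiP (SubspaceElt (mem_set Nn : n \in lsubspace_pred N)).
  move=> en; have {}en : h (n + J n) p = h (n + J n) xi by exact: en.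
  by rewrite /e ripBr /rip /= en subrr.
have eN n : lsubspace_set N n -> f e n = 0.
  apply: (@herm_eq0 _ _ f e N) => {}n Nn; rewrite fh Je.
  by have := eQ _ Nn; rewrite ripDl hJ Je ripC; lra.
have pe : rip h p e = 0.
  have := zE _ Je eN => ze.
  by rewrite /p ripDl -{1}Je -hJ -fh /rip ze /= addr0.
have xie : rip h xi e = 0.
  have : rip f xi e = 0.
    apply: (orth_adherent sJ xiQ) => _ [n _ <-].
    by rewrite fh /= linearD /= JJ addrC eQ//; exact: valN.
  by rewrite fh Jxi.
have p_xi : p = xi.
  apply/eqP; rewrite -subr_eq0; apply/eqP/(@nrm_eq0 _ _ h).
  by rewrite /nrm -/e {1}/e ripBl pe xie subr0 sqrtr0.
(* From [4 f n n = |n + J n|^2 - |n - J n|^2] and [|n + J n| <= 2 |n|]. *)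
have nn n : lsubspace_set N n -> nrm h (n - J n) ^+ 2 <= (1 - c) * nrm h (n + J n) ^+ 2.
  move=> Nn; have := diff n n; have := fc _ Nn; rewrite !nrmE.
  have : nrm h (n + J n) ^+ 2 <= 4 * nrm h n ^+ 2.
    have := nrmD h n (J n); rewrite iso; have := nrm_ge0 h (n + J n).
    by move: (nrm _ _) (nrm _ _) => a b *; nra.
  by move: (_ ^+ 2) (_ ^+ 2) (_ ^+ 2) (rip _ _ _) => A B C D *; nra.
(* Since [f z n = 0], the positive components of [z] and [n] pair to the same value as the negative
   ones, where [nn] supplies the factor; testing on such [n] is enough because [p = xi]. *)
have pm : nrm h p <= Num.sqrt (1 - c) * nrm h m.
  rewrite p_xi; apply: (adherent_dual _ xiQ); first by rewrite mulr_ge0 ?sqrtr_ge0 ?nrm_ge0.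
  move=> _ [n _ <-]; rewrite -p_xi /=.
  have := diff z (val n); rewrite /rip (zN _ (valN n)) mulr0 -!/(rip _ _ _) => /eqP.
  rewrite subr_eq0 => /eqP ->; apply: le_trans (rip_CS _ _ _) _.
  rewrite mulrAC mulrC ler_wpM2r ?nrm_ge0//.
  rewrite -(@ler_pXn2r _ 2) ?nnegrE ?mulr_ge0 ?nrm_ge0 ?sqrtr_ge0// exprMn.
  have -> : Num.sqrt (1 - c) ^+ 2 = 1 - c by rewrite sqr_sqrtr// subr_ge0.
  exact/nn/valN.
have m0 : 0 < nrm h m.
  rewrite lt0r nrm_ge0 andbT; apply: contraNneq z0 => mz.
  move: pm; rewrite mz mulr0 => p0.
  have {}p0 : p = 0 by apply: (@nrm_eq0 _ _ h); apply/eqP; rewrite eq_le p0 nrm_ge0.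
  have := nrm_eq0 mz; rewrite /m => /eqP; rewrite subr_eq0 => /eqP zJ.
  move: p0; rewrite /p -zJ -mulr2n -scaler_nat => /eqP.
  by rewrite scaler_eq0 pnatr_eq0.
have := diff z z; rewrite -/p -/m !nrmE.
have : nrm h p ^+ 2 <= (1 - c) * nrm h m ^+ 2.
  have -> : (1 - c) = Num.sqrt (1 - c) ^+ 2 by rewrite sqr_sqrtr// subr_ge0.
  by rewrite -exprMn ler_pXn2r ?nnegrE ?mulr_ge0 ?nrm_ge0 ?sqrtr_ge0.
have : 0 < nrm h m ^+ 2 by rewrite exprn_gt0.
by move: (_ ^+ 2) (_ ^+ 2) (rip _ _ _) => A B C *; nra.
Qed.

(** [N] is enlarged by the space [E] of the [J]-positive vectors orthogonal to it. The last
    conclusion, that [J]-negative vectors orthogonal to [N] stay negative, protects one application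
    of the lemma from the next. *)
Lemma uniformly_positive_extension f J h (N : lsubspace V) (c : R) :
  is_signature f J h -> closed_in h (lsubspace_set N) -> 0 < c ->
  (forall n, lsubspace_set N n -> c * nrm h n ^+ 2 <= rip f n n) ->
  exists J' h', [/\ is_signature f J' h', forall n, lsubspace_set N n -> J' n = n
    & forall z, J z = - z -> (forall n, lsubspace_set N n -> f z n = 0) -> J' z = - z].
Proof.
move=> sJ Ncl c0 fc; have [hE JJ hC _] := sJ; have iso := is_signature_iso sJ.
have fh x y : rip f x y = rip h (J x) y by rewrite /rip hE JJ.
have lE : submod_closed (mem [set e | J e = e /\ forall n, lsubspace_set N n -> f e n = 0]).
  split; first by apply/mem_set; split=> [|n _]; rewrite ?linear0 ?linear0l.
  move=> a x y /set_mem [/= Jx xN] /set_mem [/= Jy yN]; apply/mem_set; split=> [|n Nn].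
    by rewrite linearP Jx Jy.
  by rewrite linearPl /= xN// yN// mulr0 addr0.
pose E := Subspace lE.
have Ecl : closed_in h (lsubspace_set E).
  move=> x xE; split.
    apply/eqP; rewrite -subr_eq0; apply/eqP.
    apply: (@adherent_ker _ _ h _ h (J \- idfun) _ _ _ _ xE).
      by apply: bnd_sub; [exists 1 => // y; rewrite mul1r iso|exact: bnd_id].
    by move=> y [Jy _] /=; rewrite Jy subrr.
  apply: (@herm_eq0 _ _ f x N) => n Nn.
  by apply: (orth_adherent sJ xE) => y [_ yN]; rewrite /rip yN.
have lM : submod_closed (mem [set x | exists n e,
    [/\ lsubspace_set N n, lsubspace_set E e & x = n + e]]).
  split; first by apply/mem_set; exists 0, 0; split; rewrite ?addr0//; exact: subspace0.
  move=> a _ _ /set_mem [n1 [e1 [N1 E1 ->]]] /set_mem [n2 [e2 [N2 E2 ->]]].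
  apply/mem_set; exists (a *: n1 + n2), (a *: e1 + e2); split.
  - by apply: subspaceD => //; exact: subspaceZ.
  - by apply: subspaceD => //; exact: subspaceZ.
  - by rewrite scalerDr addrACA.
pose M := Subspace lM.
have hNE n e : lsubspace_set N n -> lsubspace_set E e -> rip h n e = 0.
  by move=> Nn [Je eN]; rewrite ripC -[e]Je -fh /rip eN.
(* [N] and [E] are also [h]-orthogonal, so by Pythagoras the [N]-component of an adherent point
   adheres to [N]. *)
have Mcl : closed_in h (lsubspace_set M).
  move=> x xM; have [e0 Ee0 eP] := projection (N := E) x hC Ecl.
  exists (x - e0), e0; split=> //; last by rewrite subrK.
  apply: Ncl => d /xM[_ [n [e [Nn Ee ->]]] xn]; exists n => //.
  apply: le_lt_trans xn; rewrite -(@ler_pXn2r _ 2) ?nnegrE ?nrm_ge0//.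
  have -> : x - (n + e) = (x - e0 - n) + (e0 - e).
    by rewrite [x - e0 - n]addrAC subrKA opprD addrA.
  rewrite (rip_orthD (x := x - e0 - n)) ?lerDl ?sqr_ge0//.
  have Ed : lsubspace_set E (e0 - e) by exact: subspaceB.
  by rewrite (ripBl h (x - e0)) (hNE n)// /rip /= eP// subr0.
(* The constant is [c] on [N] and [1] on [E]; [uniformly_positive_neg] also wants it to be at most
   [1]. *)
set c' := Num.min c 1.
have c'0 : 0 < c' by rewrite lt_min c0 ltr01.
have fM m : lsubspace_set M m -> c' * nrm h m ^+ 2 <= rip f m m.
  move=> [n [e [Nn Ee ->]]]; have [Je eN] := Ee.
  have fee : rip f e e = nrm h e ^+ 2 by rewrite fh Je nrmE.
  have fen : rip f e n = 0 by rewrite /rip eN.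
  rewrite rip_orthD ?hNE// ripDl !ripDr [rip f n e]ripC fen fee addr0 add0r mulrDr.
  have c'c : c' <= c by rewrite ge_min lexx.
  have c'1 : c' <= 1 by rewrite ge_min lexx orbT.
  apply: lerD; last by rewrite ler_piMl ?sqr_ge0.
  by apply: le_trans (fc _ Nn); rewrite ler_wpM2r ?sqr_ge0.
have NM n : lsubspace_set N n -> lsubspace_set M n.
  by move=> Nn; exists n, 0; split; rewrite ?addr0//; exact: subspace0.
have EM e : lsubspace_set E e -> lsubspace_set M e.
  by move=> Ee; exists 0, e; split; rewrite ?add0r//; exact: subspace0.
have [P [PM Po bP]] := coercive_projection hC Mcl (is_signature_bound sJ) c'0 fM.
have neg z : (forall n, lsubspace_set M n -> f z n = 0) -> z != 0 -> rip f z z < 0.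
  move=> zM; apply: (uniformly_positive_neg sJ c'0 _ (N := N)).
  - by rewrite ge_min lexx orbT.
  - by move=> n /NM; exact: fM.
  - by move=> n /NM; exact: zM.
  - by move=> e Je eN; apply/zM/EM.
have [J' [h' [sJ' _ J'M J'z]]] := projection_signature sJ PM Po bP c'0 fM neg.
exists J', h'; split=> // [n /NM|z Jz zN]; first exact: J'M.
apply: J'z => _ [n [e [Nn [Je eN] ->]]]; rewrite linearDr /= zN// add0r.
have := is_signature_sym sJ z e; rewrite Je Jz linearNl /= => /eqP.
by rewrite -subr_eq0 -opprD oppr_eq0 -mulr2n mulrn_eq0 => /eqP.
Qed.

(** The norms of [g0] and [h] on [S] are equivalent by [bounded_inverse], so the positive part of
    [S] for [J0] is uniformly positive for [h]. Closedness for [h'] is returned so that the lemma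
    can be applied again. *)
Lemma extend_half f J h (S : lsubspace V) (J0 : {linear S -> S}) (g0 : inner_product S) :
  is_signature f J h -> closed_in h (lsubspace_set S) -> is_signature (restr f S) J0 g0 ->
  exists J' h', [/\ is_signature f J' h', closed_in h' (lsubspace_set S),
    forall s : S, J0 s = s -> J' (val s) = val s
    & forall z, J z = - z -> (forall s : S, J0 s = s -> f z (val s) = 0) -> J' z = - z].
Proof.
move=> sJ Scl sJ0; have [_ _ hC _] := sJ; have [g0E J0J0 g0C _] := sJ0.
have b1 : bnd (restr h S) g0 idfun.
  apply: (signature_norm_le sJ0) => x y; exact: (is_signature_bound sJ).
have [K K0 hK] := bounded_inverse g0C (subspace_complete Scl hC) b1.
have lN : submod_closed (mem [set v | exists2 s : S, J0 s = s & v = val s]).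
  split; first by apply/mem_set; exists 0; rewrite ?linear0 ?raddf0.
  move=> a _ _ /set_mem [s Js ->] /set_mem [t Jt ->]; apply/mem_set.
  by exists (a *: s + t); rewrite ?linearP /= ?Js ?Jt.
pose N := Subspace lN.
have Ncl : closed_in h (lsubspace_set N).
  move=> x xN; have Sx : lsubspace_set S x.
    apply: Scl => e /xN[_ [s _ ->] xs]; exists (val s) => //; exact: valN.
  pose s := SubspaceElt (mem_set Sx : x \in lsubspace_pred S); exists s => //.
  apply/eqP; rewrite -subr_eq0; apply/eqP.
  apply: (@adherent_ker _ _ g0 _ g0 (J0 \- idfun) [set s | J0 s = s]).
  - apply: bnd_sub; last exact: bnd_id.
    by exists 1 => // t; rewrite mul1r (is_signature_iso sJ0).
  - by move=> t /= ->; rewrite subrr.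
  - apply: (adherent_equiv b1) => e /xN[_ [t Jt ->] xt]; by exists t.
have Kp : 0 < (K + 1) ^+ 2 by rewrite exprn_gt0// ltr_wpDl.
have coer n : lsubspace_set N n -> ((K + 1) ^+ 2)^-1 * nrm h n ^+ 2 <= rip f n n.
  move=> [s Js ->]; have -> : rip f (val s) (val s) = nrm g0 s ^+ 2.
    by rewrite -nrmE /rip g0E Js.
  rewrite ler_pdivrMl// -exprMn ler_pXn2r ?nnegrE ?mulr_ge0 ?nrm_ge0 ?addr_ge0//.
  apply: le_trans (hK s) _; rewrite ler_wpM2r ?nrm_ge0// lerDl//.
have [|J' [h' [sJ' J'N J'z]]] := uniformly_positive_extension sJ Ncl _ coer.
  by rewrite invr_gt0.
exists J', h'; split=> //.
- apply: closed_equiv Scl; apply: (signature_norm_le sJ); exact: (is_signature_bound sJ').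
- by move=> s Js; apply: J'N; exists s.
- by move=> z Jz zN; apply: J'z => // _ [s Js ->]; exact: zN.
Qed.

(** The second pass runs on [- f], which exchanges the two parts. It does not undo the first,
    because the positive part of [S] is fixed by [J1] and orthogonal to the negative part. *)
Lemma signature_extension f J h (S : lsubspace V) (J0 : {linear S -> S}) (g0 : inner_product S) :
  is_signature f J h -> closed_in h (lsubspace_set S) -> is_signature (restr f S) J0 g0 ->
  exists J' h', is_signature f J' h' /\ forall s : S, J' (val s) = val (J0 s).
Proof.
move=> sJ Scl sJ0.
have [J1 [h1 [sJ1 Scl1 J1p _]]] := extend_half sJ Scl sJ0.
have [||f' f'E] := @hermitian_pack R V (fun x y => - f x y).
- by move=> a x y z; rewrite linearPl opprD mulrN.
- by move=> x y; rewrite rmorphN /= -herm_sym.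
have neg_sig (U : lmodType R[i]) (k k' : hermitian_form U) (T : {linear U -> U}) q :
    (forall x y, k' x y = - k x y) -> is_signature k T q -> is_signature k' (\- T) q.
  move=> k'E [qE TT qC qS]; split=> // [x y|x] /=.
    by rewrite k'E linearNl /= opprK qE.
  by rewrite linearN /= TT opprK.
have sJ1' := neg_sig _ _ _ _ _ f'E sJ1.
have sJ0' : is_signature (restr f' S) (\- J0) g0.
  by apply: neg_sig sJ0 => x y; exact: f'E.
have [J2 [h2 [sJ2 _ J2m J2p]]] := extend_half sJ1' Scl1 sJ0'.
have sJ3 := neg_sig _ _ f _ _ _ sJ2; exists (\- J2), h2; split.
  by apply: sJ3 => x y; rewrite f'E opprK.
have [_ J0J0 _ _] := sJ0.
have Jp (s : S) : J0 s = s -> J2 (val s) = - val s.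
  move=> Js; apply: J2p => [|t /= Jt]; first by rewrite /= J1p.
  rewrite f'E; have := is_signature_sym sJ0 s t; rewrite Js -[J0 t]opprK Jt.
  rewrite linearNr /= => /eqP; rewrite -subr_eq0 opprK -mulr2n mulrn_eq0 /= => /eqP e.
  by rewrite [f _ _]e oppr0.
have Jm (s : S) : J0 s = - s -> J2 (val s) = val s.
  by move=> Js; apply: J2m; rewrite /= Js opprK.
move=> s /=.
have e1 := Jp (s + J0 s); have e2 := Jm (s - J0 s).
have {}e1 : J2 (val (s + J0 s)) = - val (s + J0 s) by apply: e1; rewrite linearD /= J0J0 addrC.
have {}e2 : J2 (val (s - J0 s)) = val (s - J0 s) by apply: e2; rewrite linearB /= J0J0 opprB.
move: e1 e2; rewrite (raddfD val) (raddfB val) (raddfD J2) (raddfB J2) /= => e1 e2.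
have := congr2 +%R e1 e2; rewrite addrACA subrr addr0 opprD addrACA addNr add0r.
rewrite -!mulr2n -[LHS]scaler_nat -[RHS]scaler_nat => /scalerI -> //; exact: opprK.
Qed.

End Extend.

(** * Comparison of moduli *)

Section Comparison.
Context (R : realType) (V : lmodType R[i]).
Implicit Types (g : inner_product V) (a u A Q : {linear V -> V}).

Lemma lsubspace_ext (S1 S2 : lsubspace V) :
  (forall x, lsubspace_set S1 x <-> lsubspace_set S2 x) -> S1 = S2.
Proof.
case: S1 S2 => [s1 h1] [s2 h2] /= /predeqP e; case: s2 / e h2 => h2.
by rewrite (Prop_irrelevance h1 h2).
Qed.

Lemma lift_linear (U : lmodType R[i]) (N : lsubspace V) (F : {linear U -> V}) :
  (forall x, lsubspace_set N (F x)) ->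
  exists G : {linear U -> N}, forall x, val (G x) = F x.
Proof.
move=> NF; pose G x : N := SubspaceElt (mem_set (NF x) : F x \in lsubspace_pred N).
have lG : linear G by move=> c x y; apply: val_inj; rewrite linearP /= linearP.
by exists (linear_of lG).
Qed.

Lemma adherent_range_submod (U : lmodType R[i]) g (Q : {linear U -> V}) :
  submod_closed (mem [set x | adherent g (range Q) x]).
Proof.
split; first by apply/mem_set => e e0; exists 0; rewrite ?subrr ?nrm0//; exists 0; rewrite ?linear0.
move=> c x y /set_mem /= xQ /set_mem /= yQ; apply/mem_set => e e0 /=.
have cp : 0 < nrm g x + complex.Re `|c| + 1.
  rewrite ltr_wpDl// addr_ge0 ?nrm_ge0//.
  by have := normr_ge0 c; rewrite lecE => /andP[_].
set k := nrm g x + _ + 1 in cp.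
have e2 : 0 < e / 2 / k by rewrite !divr_gt0.
have [_ [x1 _ <-] xx1] := xQ _ e2; have [_ [y1 _ <-] yy1] := yQ _ (divr_gt0 e0 (ltr0Sn R 1)).
exists (Q (c *: x1 + y1)); first by exists (c *: x1 + y1).
have -> : c *: x + y - Q (c *: x1 + y1) = c *: (x - Q x1) + (y - Q y1).
  by rewrite linearP scalerBr opprD addrACA.
apply: le_lt_trans (nrmD _ _ _) _; rewrite [e]splitr ltrD//.
rewrite -[nrm g (c *: _)]/(complex.Re (nrm g (c *: (x - Q x1)))%:C) -ip_normE.
rewrite (normrZ c ((x - Q x1) : ip_space g)) ip_normE mulrC Re_realM.
move: xx1; rewrite ltr_pdivlMr//; apply: le_lt_trans.
by rewrite ler_wpM2l ?nrm_ge0// /k -addrA addrC -addrA lerDl addr_ge0 ?nrm_ge0.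
Qed.

Lemma adherent_closed g (E : set V) : closed_in g [set x | adherent g E x].
Proof.
move=> x xE e e0; have e2 : 0 < e / 2 by rewrite divr_gt0.
have [y yE xy] := xE _ e2; have [z Ez yz] := yE _ e2; exists z => //.
by apply: le_lt_trans (nrm_sub _ _ y _) _; rewrite [e]splitr ltrD.
Qed.

Lemma adherent_image g (E : set V) (T : {linear V -> V}) x : bnd g g T ->
  (forall y, E y -> E (T y)) -> adherent g E x -> adherent g E (T x).
Proof.
move=> [M M0 hM] TE xE e e0; have Mp : 0 < M + 1 by rewrite ltr_wpDl.
have [y Ey] := xE _ (divr_gt0 e0 Mp); rewrite ltr_pdivlMr// => xy.
exists (T y); first exact: TE.
rewrite -linearB; apply: le_lt_trans (hM _) _; apply: le_lt_trans xy.
by rewrite mulrC ler_wpM2l ?nrm_ge0// lerDl.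
Qed.

Lemma polar_form g a u Q s t : psd g Q -> (forall x, a x = u (Q (Q x))) ->
  (forall x, u (Q x) = Q (u x)) -> rip g (u (Q s)) (Q t) = rip g (a s) t.
Proof. by move=> [sQ _] aE uQ; rewrite -sQ -uQ aE. Qed.

Lemma range_criterion g Q (v : V) (M : R) : seq_complete g -> adjoint_pair g g Q Q ->
  (forall s, rip g v s <= M * nrm g (Q s)) ->
  exists2 xi, adherent g (range Q) xi & Q xi = v.
Proof.
move=> gC sQ hM; have lp : linear (fun s => g s v : R[i]^o).
  by move=> c x y; rewrite linearPl.
have [s|xi xiQ xiP] := @riesz_range R V V g Q (linear_of lp) M gC.
  by rewrite /= -/(rip g s v) ripC.
by exists xi => //; apply: (@dot_injr _ _ g) => s; rewrite -sQ -xiP.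
Qed.

Lemma sym_eq_norm g a A : adjoint_pair g g a a -> adjoint_pair g g A A ->
  (forall x, A (A x) = a (a x)) -> forall x, nrm g (A x) = nrm g (a x).
Proof. by move=> sa sA AA x; rewrite /nrm /rip sA AA -sa. Qed.

(* [T] is the Gram operator of [g1] in [g2], so that [T A1] represents the form
   [g1 (A1 x) y] in [g2] and Heinz' inequality compares it with [A2]. *)
Lemma modulus_comparison g1 g2 a1 a2 A1 A2 Q1 Q2 : seq_complete g2 ->
  bnd g1 g2 idfun -> bnd g2 g1 idfun ->
  adjoint_pair g1 g1 a1 a1 -> adjoint_pair g2 g2 a2 a2 ->
  modulus g1 a1 A1 -> positive_sqrt g1 A1 Q1 ->
  modulus g2 a2 A2 -> positive_sqrt g2 A2 Q2 ->
  (forall x y, g1 (a1 x) y = g2 (a2 x) y) ->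
  exists2 C : R, 0 <= C & forall x, nrm g1 (Q1 x) <= C * nrm g2 (Q2 x).
Proof.
move=> c2 [C1 C10 h12] [C2 C20 h21] sa1 sa2 /(modulusP sa1)[bA1 pA1 sA1 AA1].
move=> /positive_sqrtP[_ pQ1 sQ1 QQ1] /(modulusP sa2)[bA2 pA2 sA2 AA2].
move=> /positive_sqrtP[_ pQ2 sQ2 QQ2] wE.
have [|||T TP] := @form_representation R V V g2 g1 c2.
- by move=> u c x y; rewrite linearPl.
- by move=> x c u v; rewrite linearPr.
- move=> u; exists (C2 * nrm g1 u) => x; apply: le_trans (rip_CS g1 _ _) _.
  by rewrite mulrAC ler_wpM2r ?nrm_ge0//; exact: h21.
pose B := (T \o A1) : {linear V -> V}.
have BE x y : rip g2 (B x) y = rip g1 (A1 x) y by rewrite ripC [RHS]ripC /rip /= TP.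
have pB : psd g2 B.
  have [sA1r A10] := pA1; split=> [x y|x]; last by rewrite BE.
  by rewrite BE sA1r ripC -BE ripC.
have nB x : nrm g2 (B x) <= C2 * nrm g1 (A1 x).
  apply: nrm_dual => [|y]; first by rewrite mulr_ge0 ?nrm_ge0.
  rewrite BE; apply: le_trans (rip_CS _ _ _) _.
  by rewrite [C2 * _]mulrC -mulrA ler_wpM2l ?nrm_ge0//; exact: h21.
have bB : bnd g2 g2 B.
  have [M M0 hM] := bA1; exists (C2 * (M * C2)); first by rewrite !mulr_ge0.
  move=> x; apply: le_trans (nB x) _; rewrite -mulrA ler_wpM2l//.
  by apply: le_trans (hM x) _; rewrite -mulrA ler_wpM2l//; exact: h21.
(* Both operators represent the same form, so [|a1 x|^2] in [g1] is [g2 (a2 x) (a1 x)], and only one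
   factor changes its norm. *)
have nA x : nrm g1 (A1 x) <= C1 * nrm g2 (A2 x).
  rewrite (sym_eq_norm sa1 sA1 AA1) (sym_eq_norm sa2 sA2 AA2).
  have [->|ax] := eqVneq (a1 x) 0; first by rewrite nrm0 mulr_ge0 ?nrm_ge0.
  rewrite -(ler_pM2r (nrm_gt0 g1 ax)) -expr2 -nrmE /rip wE -/(rip g2 _ _).
  apply: le_trans (rip_CS _ _ _) _; rewrite [C1 * _]mulrC -mulrA ler_wpM2l ?nrm_ge0//.
  exact: h12.
have k0 : 0 <= C2 * C1 by rewrite mulr_ge0.
have hz x := @heinz R V g2 A2 B (C2 * C1) bA2 bB pA2 pB k0 _ x.
exists (Num.sqrt (C2 * C1)); first exact: sqrtr_ge0.
move=> x; rewrite -(@ler_pXn2r _ 2) ?nnegrE ?mulr_ge0 ?nrm_ge0 ?sqrtr_ge0//.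
have s2 : Num.sqrt (C2 * C1) ^+ 2 = C2 * C1 by rewrite sqr_sqrtr.
rewrite exprMn s2 -!nrmE /rip sQ1 sQ2 -!/(rip _ _ _) QQ1 QQ2.
rewrite ![rip _ x _]ripC -BE; apply: hz => {}x.
by apply: le_trans (nB x) _; rewrite -mulrA ler_wpM2l.
Qed.

(* A continuous functional on [S] for the seminorm [|Q1 s|] is represented by
   [xi1]; choosing [s] with [Q1 s] close to [u1 xi1] approximates it by
   functionals of the form [w(_, s)], on which the two dual forms agree. *)
Lemma dual_form_invariant g1 g2 Q1 Q2 u1 u2 (C : R) (x1 y1 x2 y2 : V) :
  bnd g1 g1 u1 -> bnd g2 g2 u2 ->
  (forall x, u1 (Q1 x) = Q1 (u1 x)) -> (forall x, u2 (Q2 x) = Q2 (u2 x)) ->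
  (forall x, adherent g1 (range Q1) x -> u1 (u1 x) = x) ->
  (forall x, adherent g2 (range Q2) x -> u2 (u2 x) = x) ->
  (forall s t, rip g1 (u1 (Q1 s)) (Q1 t) = rip g2 (u2 (Q2 s)) (Q2 t)) ->
  0 <= C -> (forall s, nrm g1 (Q1 s) <= C * nrm g2 (Q2 s)) ->
  adherent g1 (range Q1) x1 -> adherent g2 (range Q2) x2 ->
  (forall s, rip g1 (Q1 s) x1 = rip g2 (Q2 s) x2) ->
  (forall s, rip g1 (Q1 s) y1 = rip g2 (Q2 s) y2) ->
  rip g1 (u1 x1) y1 = rip g2 (u2 x2) y2.
Proof.
move=> [M1 M10 hu1] [M2 M20 hu2] uQ1 uQ2 uu1 uu2 wE C0 hC x1Q x2Q xE yE.
apply/eqP; rewrite -subr_eq0 -normr_eq0 eq_le normr_ge0 andbT.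
apply: (@le_eps _ _ _ (M1 * nrm g1 y1 + M2 * (M1 * M1 * C) * nrm g2 y2)) => e e0; rewrite add0r.
have [_ [s0 _ <-] xs0] := x1Q _ e0; pose s := u1 s0.
have d1 : nrm g1 (u1 x1 - Q1 s) <= M1 * e.
  rewrite -uQ1 -linearB; apply: le_trans (hu1 _) _; rewrite ler_wpM2l// ltW//.
have d1' : nrm g1 (u1 (Q1 s) - x1) <= M1 * (M1 * e).
  rewrite -[X in _ - X](uu1 _ x1Q) -linearB; apply: le_trans (hu1 _) _; rewrite ler_wpM2l//.
  by rewrite nrmBC.
have cl : adherent g2 (range Q2) (u2 (Q2 s) - x2).
  pose N := Subspace (adherent_range_submod g2 Q2).
  have Nu : lsubspace_set N (u2 (Q2 s)).
    move=> d d0; exists (Q2 (u2 s)); first by exists (u2 s).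
    by rewrite uQ2 subrr nrm0.
  by apply: (subspaceB (N := N)).
(* By [cl] the norm can be tested on vectors [Q2 t], where [wE] and [xE] turn the pairing into one
   for [g1]. *)
have d2 : nrm g2 (u2 (Q2 s) - x2) <= M1 * (M1 * e) * C.
  apply: (adherent_dual _ cl) => [|_ [t _ <-]]; first by rewrite !mulr_ge0// ltW.
  have -> : rip g2 (u2 (Q2 s) - x2) (Q2 t) = rip g1 (u1 (Q1 s) - x1) (Q1 t).
    by rewrite !ripBl wE; congr (_ - _); rewrite ripC -xE ripC.
  apply: le_trans (rip_CS _ _ _) _; rewrite -mulrA ler_pM ?nrm_ge0//.
have d3 : nrm g2 (Q2 s - u2 x2) <= M2 * (M1 * (M1 * e) * C).
  have Qs : adherent g2 (range Q2) (Q2 s).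
    by move=> d d0; exists (Q2 s); [exists s|rewrite subrr nrm0].
  rewrite -(uu2 _ Qs) -linearB; apply: le_trans (hu2 _) _; rewrite ler_wpM2l//.
have -> : rip g1 (u1 x1) y1 - rip g2 (u2 x2) y2 =
    rip g1 (u1 x1 - Q1 s) y1 + rip g2 (Q2 s - u2 x2) y2.
  by rewrite !ripBl yE addrA subrK.
apply: le_trans (ler_normD _ _) _; rewrite mulrDr; apply: lerD.
  apply: le_trans (rip_CS_abs _ _ _) _; rewrite mulrA [e * _]mulrC.
  by rewrite ler_wpM2r ?nrm_ge0.
apply: le_trans (rip_CS_abs _ _ _) _; rewrite mulrA ler_wpM2r ?nrm_ge0//.
apply: le_trans d3 _; rewrite le_eqVlt; apply/orP; left; apply/eqP; ring.
Qed.

End Comparison.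

(** * Schur complements *)

Section Blocks.
Context (R : realType) (V : lmodType R[i]).
Variables (f : hermitian_form V) (S : lsubspace V) (W : {linear V -> V}).
Hypothesis sW : adjoint_pair f f W W.

(* The notions of the Hilbert space context with the inner product on [S] and
   the complement [T] as parameters: for a signature [J] extending one of [S],
   these can then be rewritten into [ip J0] and [orthocompl f S]. *)
Definition wc_data (gS : inner_product S) (T : lsubspace V) (B : V -> V) : Prop :=
  exists (a A Q : {linear S -> S}) (b : {linear T -> S})
         (b' : {linear S -> T}) (c : {linear T -> T}),
    [/\ block_form B a b b' c, modulus gS a A,
        positive_sqrt gS A Q & range b `<=` range Q].

Definition schur_data (gS : inner_product S) (T : lsubspace V) (gT : inner_product T)
    (B X : V -> V) : Prop :=
  exists (a A Q u : {linear S -> S}) (b x : {linear T -> S})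
         (b' x' : {linear S -> T}) (c : {linear T -> T}),
    [/\ block_form B a b b' c,
        polar_decomposition gS a u A /\ positive_sqrt gS A Q,
        reduced_solution gT gS Q b x,
        adjoint_pair gT gS x x'
      & block_form (S := S) (T := T) X (fun=> 0) (fun=> 0) (fun=> 0)
          (fun t => c t - x' (u (x t)))].

Variables (J : signature f).
Hypothesis Scl : closed_in (ip J) (lsubspace_set S).
Local Notation g := (ip J).
Local Notation gS := (restr (ip J) S).
Local Notation T := (orthocompl (ip J) S).

Lemma ipE x y : f x y = ip J (J x) y.
Proof. exact: is_signature_form (signature_is J) x y. Qed.

Lemma orthoP (t : T) (s : S) : ip J (val t) (val s) = 0.
Proof. exact: (valN t) (valN s). Qed.

Lemma orthoP' (t : T) (s : S) : ip J (val s) (val t) = 0.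
Proof. by rewrite herm_sym /= orthoP conjC0. Qed.

Lemma ortho_decomp x : exists (s : S) (t : T), x = val s + val t.
Proof.
have [_ _ hC _] := signature_is J.
have [n Nn nP] := projection x hC Scl.
exists (SubspaceElt (mem_set Nn : n \in lsubspace_pred S)).
by exists (SubspaceElt (mem_set nP : x - n \in lsubspace_pred T)); rewrite addrC subrK.
Qed.

Section Entries.
Variables (a : {linear S -> S}) (b : {linear T -> S}) (b' : {linear S -> T})
  (c : {linear T -> T}).
Hypothesis blk : block_form (J \o W) a b b' c.

Lemma block_a (s s' : S) : gS (a s) s' = f (W (val s)) (val s').
Proof.
by have [h _] := blk; rewrite ipE; have /= -> := h s; rewrite linearDl /= orthoP addr0.
Qed.

Lemma block_b (t : T) (s : S) : gS (b t) s = f (W (val t)) (val s).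
Proof.
by have [_ h] := blk; rewrite ipE; have /= -> := h t; rewrite linearDl /= orthoP addr0.
Qed.

Lemma block_c (t t' : T) : ip J (val (c t)) (val t') = f (W (val t)) (val t').
Proof.
by have [_ h] := blk; rewrite [RHS]ipE; have /= -> := h t; rewrite linearDl /= orthoP' add0r.
Qed.

Lemma block_a_sym : adjoint_pair gS gS a a.
Proof. by move=> s s'; rewrite block_a sW herm_sym -block_a [RHS]herm_sym. Qed.

End Entries.

(** The bound is stated for every [x], since a vector of [orthocompl f S] may have a component in
    [S] for the splitting by [ip J]. That component is controlled through [|a s| = |Q (Q s)|]. *)
Lemma weakly_complementable_bound : hilbert_weakly_complementable (ip J) S (J \o W) ->
  exists a A Q : {linear S -> S},
  [/\ adjoint_pair gS gS a a, modulus gS a A, positive_sqrt gS A Q,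
      forall s s' : S, gS (a s) s' = f (W (val s)) (val s')
    & forall x, exists M : R, forall s : S, rip f (W x) (val s) <= M * nrm gS (Q s)].
Proof.
move=> [a [A [Q [b [b' [c [blk mod sq bQ]]]]]]]; exists a, A, Q; split=> //.
- exact: block_a_sym blk.
- exact: block_a blk.
move=> x; have [s1 [t1 ->]] := ortho_decomp x.
have [_ _ sA AA] := modulusP (block_a_sym blk) mod.
have [[N N0 hN] _ sQ QQ] := positive_sqrtP sq.
have [xi _ xiE] := bQ (b t1) (ex_intro2 _ _ t1 I erefl).
exists (nrm gS s1 * N + nrm gS xi) => s.
rewrite linearD ripDl /rip -(block_a blk) -(block_b blk) -!/(rip _ _ _) mulrDl.
apply: lerD; last by rewrite -xiE /rip sQ; exact: rip_CS.
rewrite /rip (block_a_sym blk) -/(rip _ _ _); apply: le_trans (rip_CS _ _ _) _.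
rewrite -mulrA ler_wpM2l ?nrm_ge0// -(sym_eq_norm (block_a_sym blk) sA AA) -QQ.
exact: hN.
Qed.

(* The Schur complement form is [w(x, y) - <u xi_x, xi_y>], where [Q xi_x]
   represents the functional [w(x, _)] on [S]: for [x = s + t] with [t] in the
   orthogonal complement, [xi_x = u Q s + x t]. *)
Lemma schur_form Y : seq_complete g ->
  hilbert_schur_complement (ip J) S (J \o W) Y ->
  exists a A Q u : {linear S -> S},
  [/\ adjoint_pair gS gS a a, polar_decomposition gS a u A, positive_sqrt gS A Q,
      forall s s' : S, gS (a s) s' = f (W (val s)) (val s')
    & [/\ forall s : S, Y (val s) = 0, forall x (s : S), f (J (Y x)) (val s) = 0
    & forall x, exists xi : S, [/\ adherent gS (range Q) xi,
       forall s, rip gS (Q s) xi = rip f (W x) (val s)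
     & forall y eta, adherent gS (range Q) eta ->
         (forall s, rip gS (Q s) eta = rip f (W y) (val s)) ->
         rip f (J (Y x)) y = rip f (W x) y - rip gS (u xi) eta]]].
Proof.
move=> gC [a [A [Q [u [b [x [b' [x' [c data]]]]]]]]].
move: data => [blk [pd sq] [bx bxE x0 xcl] xx' [YS YT]].
exists a, A, Q, u; have sa := block_a_sym blk; split=> //; first exact: block_a blk.
have gSC := subspace_complete Scl gC.
have [bu aE uQ uu us] := polar_commute gSC sa pd sq.
have [_ _ sQ QQ] := positive_sqrtP sq.
have Y0 (s : S) : Y (val s) = 0 by rewrite YS !raddf0 addr0.
have YTt (t : T) : Y (val t) = val (c t - x' (u (x t))) by rewrite YT raddf0 add0r.
have xQ t : adherent gS (range Q) (x t).
  by apply/closure_adherent/xcl; exists t.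
have QQcl s : adherent gS (range Q) (Q s).
  by move=> e e0; exists (Q s); [exists s|rewrite subrr nrm0].
have JYS v (s : S) : f (J (Y v)) (val s) = 0.
  have [s1 [t1 ->]] := ortho_decomp v.
  by rewrite linearD Y0 add0r YTt -[f _ _]/(ip J _ _) orthoP.
split=> // v.
have [s1 [t1 vE]] := ortho_decomp v.
have sQr s s' : rip gS (Q s) s' = rip gS s (Q s') by rewrite /rip sQ.
have ra (s s' : S) : rip gS (a s) s' = rip f (W (val s)) (val s').
  by rewrite /rip (block_a blk).
have rb (t : T) (s : S) : rip gS (b t) s = rip f (W (val t)) (val s).
  by rewrite /rip (block_b blk).
have sWr y z : rip f (W y) z = rip f (W z) y by rewrite ripC /rip -sW.
have Qu (s s0 : S) : rip gS (Q s) (u (Q s0)) = rip f (W (val s0)) (val s).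
  by rewrite sQr -uQ -aE [LHS]ripC ra.
have Qx (s : S) t : rip gS (Q s) (x t) = rip f (W (val t)) (val s).
  by rewrite sQr -bxE [LHS]ripC rb.
have xiP (s0 : S) (t0 : T) s :
    rip gS (Q s) (u (Q s0) + x t0) = rip f (W (val s0 + val t0)) (val s).
  by rewrite linearD ripDl ripDr Qu Qx.
exists (u (Q s1) + x t1); split.
- pose N := Subspace (adherent_range_submod gS Q).
  by apply: (subspaceD (N := N)); [rewrite uQ; exact: QQcl|exact: xQ].
- by move=> s; rewrite xiP vE.
move=> y eta etaQ etaP; have [s2 [t2 yE]] := ortho_decomp y.
have etaE : eta = u (Q s2) + x t2.
  apply/eqP; rewrite -subr_eq0; apply/eqP.
  pose N := Subspace (adherent_range_submod gS Q).
  apply: (@orth_injective _ _ gS Q) => //.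
    apply: (subspaceB (N := N)) => //.
    by apply: (subspaceD (N := N)); [rewrite uQ; exact: QQcl|exact: xQ].
  apply: (@rip_inj _ _ gS) => s; rewrite rip0l ripC -sQr.
  by rewrite ripBr etaP xiP yE subrr.
have -> : rip f (J (Y v)) y = rip f (W (val t1)) (val t2) - rip gS (u (x t1)) (x t2).
  rewrite {1}yE ripDr {1}/rip JYS add0r vE linearD Y0 add0r YTt.
  rewrite -[rip f _ _]/(rip (ip J) (val (c t1 - x' (u (x t1)))) (val t2)).
  have -> : rip (ip J) (val (c t1 - x' (u (x t1)))) (val t2) =
      rip (ip J) (val (c t1)) (val t2) - rip (ip J) (val (x' (u (x t1)))) (val t2).
    by rewrite raddfB ripBl.
  have -> : rip (ip J) (val (c t1)) (val t2) = rip f (W (val t1)) (val t2).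
    by rewrite /rip -(block_c blk).
  congr (_ - _); rewrite [LHS]ripC [RHS]ripC.
  exact: (congr1 (@complex.Re R) (esym (xx' t2 (u (x t1))))).
(* Since [u u = 1] on the closure of the range of [Q], the terms of [f (W v) y] that involve [S]
   agree with those of [<u xi, eta>] and cancel. *)
have e1 : rip f (W (val s1)) (val s2) = rip gS (u (u (Q s1))) (u (Q s2)).
  rewrite uu; last exact: QQcl.
  by rewrite Qu sWr.
have e2 : rip f (W (val s1)) (val t2) = rip gS (u (u (Q s1))) (x t2).
  rewrite uu; last exact: QQcl.
  by rewrite Qx sWr.
have e3 : rip f (W (val t1)) (val s2) = rip gS (u (x t1)) (u (Q s2)).
  have -> : rip gS (u (x t1)) (u (Q s2)) = rip gS (x t1) (u (u (Q s2))).
    by rewrite /rip us// uQ; exact: QQcl.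
  rewrite uu; last exact: QQcl.
  by rewrite [RHS]ripC Qx.
rewrite etaE vE yE (linearD W).
have -> : rip gS (u (u (Q s1) + x t1)) (u (Q s2) + x t2) =
    rip gS (u (u (Q s1))) (u (Q s2)) + rip gS (u (u (Q s1))) (x t2) +
    (rip gS (u (x t1)) (u (Q s2)) + rip gS (u (x t1)) (x t2)).
  by rewrite linearD ripDl !ripDr.
rewrite ripDl !ripDr e1 e2 e3.
by do 2! rewrite opprD addrACA subrr add0r.
Qed.

End Blocks.

Lemma regular_closed (R : realType) (H : lmodType R[i]) (f : hermitian_form H) (S : lsubspace H)
    (J : signature f) : regular_subspace f S -> closed_in (ip J) (lsubspace_set S).
Proof.
move=> [[J1 /closedP cl1] _]; apply: closed_equiv cl1.
apply: (signature_norm_le (signature_is J1)); exact: (is_signature_bound (signature_is J)).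
Qed.

(** * The polar factorization, the solution and its Schur complement *)

Section Assembly.
Context (R : realType) (H : lmodType R[i]).
Variables (f : hermitian_form H) (W : {linear H -> H}) (S : lsubspace H).
Local Notation T := (orthocompl f S).
Local Notation fS := (restr f S).
Local Notation fT := (restr f (orthocompl f S)).
Variables (w11 : {linear S -> S}) (w12 : {linear T -> S}) (w12' : {linear S -> T})
  (w22 : {linear T -> T}) (K : lsubspace S) (fK : hermitian_form K) (d : {linear K -> S}).
Hypotheses (sW : adjoint_pair f f W W) (blk : block_form W w11 w12 w12' w22)
  (w12_adj : adjoint_pair fT fS w12 w12').
Variables (J0 : signature fS) (U A Q : {linear S -> S}).
Hypotheses (pd : polar_decomposition (ip J0) (J0 \o w11) U A)
  (sq : positive_sqrt (ip J0) A Q)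
  (KE : lsubspace_set K = closure (range A : set (ip_space (ip J0))))
  (fKE : forall k k' : K, fK k k' = ip J0 (U (val k)) (val k'))
  (dE : forall k : K, d k = J0 (Q (val k))).
Local Notation g0 := (ip J0).

Lemma fST (s : S) (t : T) : f (val t) (val s) = 0.
Proof. exact: (valN t) (valN s). Qed.

Lemma fTS (s : S) (t : T) : f (val s) (val t) = 0.
Proof. by rewrite herm_sym fST conjC0. Qed.

Lemma w11E (s s' : S) : fS (w11 s) s' = f (W (val s)) (val s').
Proof. by have [h _] := blk; rewrite h linearDl /= fST addr0. Qed.

Lemma w12E (t : T) (s : S) : fS (w12 t) s = f (W (val t)) (val s).
Proof. by have [_ h] := blk; rewrite h linearDl /= fST addr0. Qed.

Lemma w22E (t t' : T) : fT (w22 t) t' = f (W (val t)) (val t').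
Proof. by have [_ h] := blk; rewrite h linearDl /= fTS add0r. Qed.

Lemma fS_g0 (s s' : S) : g0 (J0 s) s' = fS s s'.
Proof. by rewrite (is_signature_form (signature_is J0)). Qed.

Lemma a0E (s s' : S) : g0 ((J0 \o w11) s) s' = f (W (val s)) (val s').
Proof. by rewrite -w11E -fS_g0. Qed.

Lemma a0_sym : adjoint_pair g0 g0 (J0 \o w11) (J0 \o w11).
Proof. by move=> s s'; rewrite a0E sW herm_sym -a0E [RHS]herm_sym. Qed.

Lemma g0_complete : seq_complete g0.
Proof. by have [_ _ ? _] := signature_is J0. Qed.

(** [A] and [Q] have the same range closure: the component of [s] orthogonal to the range of
    [A = Q Q] is killed by [Q], yet adheres to the range of [Q]. *)
Lemma K_adherent (s : S) : lsubspace_set K s <-> adherent g0 (range Q) s.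
Proof.
have [_ _ sQ QQ] := positive_sqrtP sq.
rewrite KE; split=> [/closure_adherent sA|sQs].
  by move=> e /sA[_ [x _ <-] xs]; exists (A x) => //; exists (Q x).
apply/closure_adherent.
pose N := Subspace (adherent_range_submod g0 A).
have Ncl : closed_in g0 (lsubspace_set N) by exact: adherent_closed.
have [n Nn nP] := projection (N := N) s g0_complete Ncl.
suff -> : s = n by [].
apply/eqP; rewrite -subr_eq0; apply/eqP.
have QA : Q (Q (s - n)) = 0.
  apply: (@dot_injr _ _ g0) => z; transitivity (g0 (A z) (s - n)).
    by rewrite -QQ; exact: etrans (esym (sQ _ _)) (esym (sQ _ _)).
  rewrite linear0r.
  have NA : lsubspace_set N (A z) by move=> e e0; exists (A z); [exists z|rewrite subrr nrm0].
  exact: herm_orthC (nP _ NA).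
apply: (orth_injective sQ _ (psd_ker sQ QA)).
apply: (subspaceB (N := Subspace (adherent_range_submod g0 Q))) => //.
by move=> e /Nn[_ [x _ <-] xs]; exists (A x) => //; exists (Q x).
Qed.

Lemma d_injective : injective d.
Proof.
move=> k k'; rewrite !dE => e; apply/val_inj/eqP; rewrite -subr_eq0; apply/eqP.
have [_ JJ _ _] := signature_is J0; have [_ _ sQ _] := positive_sqrtP sq.
have {}e : Q (val k) = Q (val k') by rewrite -[LHS]JJ e JJ.
apply: (orth_injective sQ); last by rewrite linearB /= e subrr.
by apply/K_adherent; apply: subspaceB; exact: valN.
Qed.

(** [range_criterion] finds its solution in the closure of the range of [Q], which is [K]; hence
    restricting [J0 Q] to [K] loses nothing of its range. *)
Lemma range_d_bound (s : S) :
  range d s <-> exists M : R, forall s', rip fS s s' <= M * nrm g0 (Q s').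
Proof.
have [_ JJ _ _] := signature_is J0; have [_ _ sQ _] := positive_sqrtP sq.
split=> [[k _ <-]|[M hM]].
  exists (nrm g0 (val k)) => s'.
  by rewrite /rip -fS_g0 dE JJ sQ; exact: rip_CS.
have [s'|xi /K_adherent Kxi xiE] := @range_criterion _ _ g0 Q (J0 s) M g0_complete sQ.
  apply: le_trans (hM s'); rewrite le_eqVlt; apply/orP; left; apply/eqP.
  exact: (congr1 (@complex.Re R) (fS_g0 s s')).
exists (SubspaceElt (mem_set Kxi : xi \in lsubspace_pred K)) => //.
by rewrite dE /= xiE JJ.
Qed.

Lemma norm_equivalence (J : signature f) : closed_in (ip J) (lsubspace_set S) ->
  bnd (restr (ip J) S) g0 idfun /\ bnd g0 (restr (ip J) S) idfun.
Proof.
move=> Scl; have [_ _ gC _] := signature_is J.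
have b : bnd (restr (ip J) S) g0 idfun.
  apply: (signature_norm_le (signature_is J0)) => x y.
  exact: (is_signature_bound (signature_is J)).
by split=> //; apply: bounded_inverse => //; [exact: g0_complete|exact: subspace_complete].
Qed.

Lemma weakly_complementable_range : regular_subspace f S ->
  weakly_complementable f S W -> range w12 `<=` range d.
Proof.
move=> Sreg [J wc] _ [t _ <-]; have Scl := regular_closed (J := J) Sreg.
have [a [A1 [Q1 [sa mod1 sq1 aE bound]]]] := weakly_complementable_bound sW Scl wc.
have [b1 b2] := norm_equivalence Scl.
have [mod0 _ _ _] := pd.
have [C C0 hC] := modulus_comparison g0_complete b1 b2 sa a0_sym mod1 sq1 mod0 sq
  (fun s s' => etrans (aE s s') (esym (a0E s s'))).
have [M hM] := bound (val t); apply/range_d_bound; exists (`|M| * C) => s.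
rewrite /rip w12E; apply: le_trans (hM s) _; rewrite -mulrA.
apply: le_trans (_ : `|M| * nrm (restr (ip J) S) (Q1 s) <= _).
  by rewrite ler_wpM2r ?nrm_ge0// ler_norm.
by rewrite ler_wpM2l.
Qed.

(** * Signatures of the whole space that extend the one on [S] *)

Section AdaptedSignature.
Variables (J : signature f) (JS : forall s : S, J (val s) = val (J0 s)).
Hypothesis Scl : closed_in (ip J) (lsubspace_set S).

Lemma adapted_inner : @eq (inner_product S) (restr (ip J) S) g0.
Proof. by apply: inner_product_ext => x y; rewrite /= /restr /ip JS. Qed.

Lemma adapted_stable s : lsubspace_set S s -> lsubspace_set S (J s).
Proof.
move=> Ss; rewrite -[s]/(val (SubspaceElt (mem_set Ss : s \in lsubspace_pred S))) JS.
exact: valN.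
Qed.

(** [J] is an [f]-symmetric involution that preserves [S], so orthogonality to [S] for [f (J _) _]
    and for [f] is the same. *)
Lemma adapted_ortho : orthocompl (ip J) S = T.
Proof.
have sJ := is_signature_sym (signature_is J); have [_ JJ _ _] := signature_is J.
apply: lsubspace_ext => x; split=> /= h s Ss.
  have e : f (J x) (J s) = 0 := h _ (adapted_stable Ss).
  by rewrite sJ JJ in e.
by change (f (J x) s = 0); rewrite sJ; exact/h/adapted_stable.
Qed.

Lemma adapted_decomp x : exists (s : S) (t : T), x = val s + val t.
Proof. by have := ortho_decomp Scl x; rewrite adapted_ortho. Qed.

Lemma adapted_T : exists J1 : {linear T -> T}, forall t, val (J1 t) = J (val t).
Proof.
apply: (@lift_linear _ _ _ T (J \o val)) => t /= s Ss.
rewrite (is_signature_sym (signature_is J)); exact/(valN t)/adapted_stable.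
Qed.

Lemma adapted_block (J1 : {linear T -> T}) : (forall t, val (J1 t) = J (val t)) ->
  block_form (J \o W) (J0 \o w11) (J0 \o w12) (J1 \o w12') (J1 \o w22).
Proof.
move=> J1E; have [h1 h2] := blk; split=> [s|t] /=.
  by rewrite h1 linearD /= JS J1E.
by rewrite h2 linearD /= JS J1E.
Qed.

Lemma range_weakly_complementable : range w12 `<=` range d -> weakly_complementable f S W.
Proof.
move=> wd; exists J; have [J1 J1E] := adapted_T.
rewrite -[hilbert_weakly_complementable _ _ _]/(wc_data (restr (ip J) S) (orthocompl (ip J) S) (J \o W)).
rewrite adapted_inner adapted_ortho.
have [mod0 _ _ _] := pd.
exists (J0 \o w11), A, Q, (J0 \o w12), (J1 \o w12'), (J1 \o w22); split=> //.
  exact: adapted_block.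
move=> _ [t _ <-] /=; have [k _ <-] := wd (w12 t) (ex_intro2 _ _ t Logic.I erefl).
have [_ JJ _ _] := signature_is J0.
by rewrite dE JJ; exists (val k).
Qed.

Local Notation gT := (restr (ip J) T).
Local Notation gK := (restr (ip J0) K).

Lemma T_signature (J1 : {linear T -> T}) : (forall t, val (J1 t) = J (val t)) ->
  is_signature fT J1 gT.
Proof.
move=> J1E; have [_ JJ gC gD] := signature_is J.
have Tcl : closed_in (ip J) (lsubspace_set T).
  move=> x xT; apply: (@herm_eq0 _ _ f x S) => s Ss.
  by apply: (orth_adherent (signature_is J) xT) => z Tz; rewrite /rip Tz.
split=> [x y|x||]; [|by apply: val_inj; rewrite !J1E JJ|exact: subspace_complete|].
  by change (ip J (val x) (val y) = f (val (J1 x)) (val y)); rewrite J1E.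
exact: subspace_separable.
Qed.

Lemma gT_form (J1 : {linear T -> T}) : (forall t, val (J1 t) = J (val t)) ->
  forall t t' : T, gT t (J1 t') = fT t t'.
Proof.
move=> /T_signature sT t t'; have [gTE J1J1 _ _] := sT.
exact: etrans (gTE _ _) (etrans (is_signature_sym sT _ _) (congr1 (fT t) (J1J1 t'))).
Qed.

Let polar0 := polar_commute g0_complete a0_sym pd sq.

(** [U] commutes with [Q] and therefore preserves [K], the closure of the range of [Q], on which
    [U U = 1]. *)
Lemma K_signature : exists JK : {linear K -> K}, is_signature fK JK gK.
Proof.
have [bU _ UQ UU _] := polar0; have [_ _ _ gD] := signature_is J0.
have KU k : lsubspace_set K k -> lsubspace_set K (U k).
  move=> /K_adherent kQ; apply/K_adherent; apply: adherent_image kQ => // _ [x _ <-].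
  by rewrite UQ; exists (U x).
have Kcl : closed_in g0 (lsubspace_set K).
  move=> x xK; apply/K_adherent/adherent_closed => e /xK[y /K_adherent yQ xy].
  by exists y.
have [JK JKE] := @lift_linear _ _ _ K (U \o val) (fun k => KU _ (valN k)).
have UUK (k : K) : U (U (val k)) = val k by apply/UU/K_adherent/valN.
exists JK; split=> [k k'|k||].
- by rewrite fKE JKE /= UUK.
- by apply: val_inj; rewrite JKE /= JKE /= UUK.
- exact: subspace_complete g0_complete.
- exact: subspace_separable g0_complete gD.
Qed.

(** Injectivity of [d] gives linearity. For boundedness, [J1 w12'] is the Hilbert adjoint of [Q y]:
    its values at the [s] with [|Q s| <= 1] are pointwise bounded by [|y t|], hence uniformly, and
    the vectors [Q s] are dense in [K]. *)
Lemma solution_exists : range w12 `<=` range d ->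
  exists y : {linear T -> K}, (forall t, w12 t = d (y t)) /\ bnd gT gK y.
Proof.
move=> wd; have [J1 J1E] := adapted_T.
have sT := T_signature J1E; have [gTE J1J1 gTC _] := sT.
have [_ J0J0 _ _] := signature_is J0.
have [_ psQ _ _] := positive_sqrtP sq; have [sQr _] := psQ.
have /choice[y0 y0P] : forall t, exists k, w12 t = d k.
  by move=> t; have [k _ <-] := wd _ (ex_intro2 _ _ t Logic.I erefl); exists k.
have ly : linear y0.
  by move=> c t t'; apply: d_injective; rewrite linearP -!y0P linearP.
exists (linear_of ly); split; first exact: y0P.
have key (t : T) (s : S) : rip gT t (J1 (w12' s)) = rip g0 (val (y0 t)) (Q s).
  rewrite -sQr.
  have -> : Q (val (y0 t)) = J0 (w12 t) by rewrite y0P dE J0J0.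
  congr complex.Re; apply: etrans (gT_form J1E _ _) _.
  exact: etrans (esym (w12_adj t s)) (esym (fS_g0 (w12 t) s)).
have [t|M M0 hM] := weakly_bounded (Z := [set z : T | exists2 s : S, nrm g0 (Q s) <= 1 &
    z = J1 (w12' s)]) gTC.
  exists (nrm g0 (val (y0 t))) => _ [s s1 ->]; rewrite key.
  by apply: le_trans (rip_CS_abs _ _ _) _; rewrite ler_piMr ?nrm_ge0.
have hM' (s : S) : nrm gT (J1 (w12' s)) <= M * nrm g0 (Q s).
  have [Qs|Qs] := eqVneq (Q s) 0.
    rewrite Qs nrm0 mulr0; suff -> : J1 (w12' s) = 0 by rewrite nrm0.
    by apply: (@rip_inj _ _ gT) => t; rewrite ripC rip0l [LHS]key Qs rip0r.
  have Qp := nrm_gt0 g0 Qs.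
  have : nrm gT (J1 (w12' ((nrm g0 (Q s))^-1%:C *: s))) <= M.
    apply: hM; exists ((nrm g0 (Q s))^-1%:C *: s) => //.
    by rewrite linearZ /= nrmZ ger0_norm ?invr_ge0 ?(ltW Qp)// mulVf ?lexx ?lt0r_neq0.
  by rewrite !linearZ /= nrmZ ger0_norm ?invr_ge0 ?(ltW Qp)// mulrC ler_pdivrMr.
exists M => // t; have /K_adherent yQ := valN (y0 t).
change (nrm g0 (val (y0 t)) <= M * nrm gT t).
apply: (adherent_dual _ yQ) => [|_ [s _ <-]]; first by rewrite mulr_ge0 ?nrm_ge0.
rewrite -key; apply: le_trans (rip_CS _ _ _) _.
by rewrite [M * _]mulrC -mulrA ler_wpM2l ?nrm_ge0//; exact: hM'.
Qed.

Lemma solution_adjoint (y : {linear T -> K}) : bnd gT gK y ->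
  exists y' : {linear K -> T}, adjoint_pair fT fK y y'.
Proof.
move=> [M M0 hM]; have [J1 J1E] := adapted_T; have [JK sK] := K_signature.
have sT := T_signature J1E; have [gTE J1J1 gTC _] := sT.
have [|||P PP] := @form_representation R K T gT (fun t k => fK (y t) k) gTC.
- by move=> k c t t'; rewrite linearP linearPl.
- by move=> t c k k'; rewrite linearPr.
- move=> k; exists (M * nrm gK k) => t; apply: le_trans (ler_norm _) _.
  apply: le_trans (is_signature_bound sK _ _) _.
  by rewrite mulrAC ler_wpM2r ?nrm_ge0.
(* [P] represents [fK (y t) k] in the Hilbert inner product [gT]; [J1] converts this to the
   indefinite form. *)
exists (J1 \o P) => t k; rewrite PP -(gT_form J1E) /=; congr (gT t _); exact: esym (J1J1 _).
Qed.

Section Solution.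
Variables (y : {linear T -> K}) (y' : {linear K -> T}).
Hypotheses (yE : forall t, w12 t = d (y t)) (y_bnd : bnd gT gK y)
  (yy' : adjoint_pair fT fK y y').

Lemma Q_solution t : Q (val (y t)) = J0 (w12 t).
Proof. by have [_ J0J0 _ _] := signature_is J0; rewrite yE dE J0J0. Qed.

(** The metric of [K] is given by [U], so the Krein adjoint hides a factor [U] that the Hilbert
    space formula displays. *)
Lemma solution_form (t t' : T) :
  rip fT (y' (y t)) t' = rip g0 (U (val (y t))) (val (y t')).
Proof.
rewrite [LHS]ripC; transitivity (rip fK (y t') (y t)).
  exact: (congr1 (@complex.Re R) (esym (yy' t' (y t)))).
rewrite ripC; exact: (congr1 (@complex.Re R) (fKE _ _)).
Qed.

Lemma solution_functional (t : T) (s : S) :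
  rip g0 (Q s) (val (y t)) = rip f (W (val t)) (val s).
Proof.
have [_ [sQr _] _ _] := positive_sqrtP sq.
rewrite sQr Q_solution [LHS]ripC; congr complex.Re.
exact: etrans (fS_g0 _ _) (w12E _ _).
Qed.

(** The blocks for [J'] are not those of [f], so [X] is identified through its form. By
    [solution_functional], [y t] represents the functional of [t] for the data [Q], [U], and
    [dual_form_invariant] compares it with the data of [J']. *)
Lemma schur_complement_block (X : {linear H -> H}) : regular_subspace f S ->
  schur_complement f S W X ->
  block_form (S := S) (T := T) X (fun=> 0) (fun=> 0) (fun=> 0) (fun t => w22 t - y' (y t)).
Proof.
move=> Sreg [J' [Y [hs XE]]]; have Scl' := regular_closed (J := J') Sreg.
have [_ _ gC' _] := signature_is J'.
have [a [A1 [Q1 [u [sa pd1 sq1 aE [Y0 JYS xiP]]]]]] := schur_form sW Scl' gC' hs.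
have gSC := subspace_complete Scl' gC'.
have [bu aE1 uQ uu us] := polar_commute gSC sa pd1 sq1.
have [bU aE0 UQ UU Us] := polar0.
have [mod1 _ _ _] := pd1; have [mod0 _ _ _] := pd.
have [b1 b2] := norm_equivalence Scl'.
have [C C0 hC] := modulus_comparison g0_complete b1 b2 sa a0_sym mod1 sq1 mod0 sq
  (fun s s' => etrans (aE s s') (esym (a0E s s'))).
have [_ pQ1 _ _] := positive_sqrtP sq1; have [_ pQ _ _] := positive_sqrtP sq.
split=> [s|t]; first by rewrite XE Y0 raddf0 raddf0 addr0.
have ext x z : (forall v, rip f x v = rip f z v) -> x = z.
  move=> h; apply: (@rip_inj _ _ (ip J)) => v.
  have e w : rip (ip J) w v = rip f w (J v).
    by rewrite /rip -(is_signature_sym (signature_is J)).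
  by rewrite !e h.
apply: ext => v; rewrite raddf0 add0r; have [s2 [t2 ->]] := adapted_decomp v.
rewrite !ripDr /rip XE JYS fST !add0r -!/(rip _ _ _).
have [xi [xiQ xiE xiF]] := xiP (val t); have [eta [etaQ etaE _]] := xiP (val t2).
rewrite (xiF _ _ etaQ etaE).
have -> : rip f (val (w22 t - y' (y t))) (val t2) =
    rip f (W (val t)) (val t2) - rip g0 (U (val (y t))) (val (y t2)).
  rewrite raddfB ripBl; congr (_ - _); last exact: solution_form.
  exact: (congr1 (@complex.Re R) (w22E t t2)).
congr (_ - _).
have wE s s' : rip (restr (ip J') S) (u (Q1 s)) (Q1 s') = rip g0 (U (Q s)) (Q s').
  apply: etrans (polar_form _ _ pQ1 aE1 uQ) _.
  apply: etrans _ (esym (polar_form _ _ pQ aE0 UQ)).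
  exact: (congr1 (@complex.Re R) (etrans (aE s s') (esym (a0E s s')))).
have yQ : adherent g0 (range Q) (val (y t)) by apply/K_adherent/valN.
exact: (dual_form_invariant bu bU uQ UQ uu UU wE C0 hC xiQ yQ
  (fun s => etrans (xiE s) (esym (solution_functional t s)))
  (fun s => etrans (etaE s) (esym (solution_functional t2 s)))).
Qed.

(** For the adapted signature, [y] regarded as a map into [S] is the reduced solution of
    [J0 w12 = Q x]. *)
Lemma block_schur_complement (X : {linear H -> H}) :
  block_form (S := S) (T := T) X (fun=> 0) (fun=> 0) (fun=> 0) (fun t => w22 t - y' (y t)) ->
  schur_complement f S W X.
Proof.
move=> [XS XT]; have [J1 J1E] := adapted_T.
have sT := T_signature J1E; have [gTE J1J1 gTC _] := sT.
have [_ J0J0 _ _] := signature_is J0; have [_ JJ _ _] := signature_is J.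
have [_ _ sQ _] := positive_sqrtP sq; have [_ _ _ _ Us] := polar0.
exists J, (J \o X); split; last by move=> x /=; rewrite JJ.
rewrite -[hilbert_schur_complement _ _ _ _]/(schur_data (restr (ip J) S)
  (restr (ip J) (orthocompl (ip J) S)) (J \o W) (J \o X)).
rewrite adapted_inner adapted_ortho.
pose x : {linear T -> S} := val \o y.
have bx : bnd gT g0 x by [].
have [x' xx'] := adjoint_exists gTC bx.
have yQ t : adherent g0 (range Q) (x t) by apply/K_adherent/valN.
exists (J0 \o w11), A, Q, U, (J0 \o w12), x, (J1 \o w12'), x', (J1 \o w22).
split=> //; first exact: adapted_block.
- split=> [|t|t|_ [t _ <-]]; [exact/bounded_opP|by rewrite /= Q_solution| |].
  + split=> [xt|/= bt]; first by rewrite /= -Q_solution [val (y t)]xt linear0.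
    by apply: (orth_injective sQ (yQ t)); rewrite Q_solution.
  + exact/closure_adherent.
split=> [s|t] /=; first by rewrite XS !raddf0 addr0 raddf0.
(* [U] comes from the metric of [K] and [J1] from that of the complement, when the Krein adjoint
   [y'] is traded for the Hilbert adjoint [x']. *)
have e : J1 (y' (y t)) = x' (U (x t)).
  apply: (@dot_injr _ _ gT) => t2; apply: etrans (gT_form J1E _ _) _.
  apply: etrans (esym (yy' t2 (y t))) _; apply: etrans (fKE _ _) _.
  exact: etrans (Us _ _ (yQ t)) (xx' t2 (U (x t))).
by rewrite XT !raddf0 !add0r -J1E linearB /= e.
Qed.

End Solution.
End AdaptedSignature.
End Assembly.

Theorem theorem4p17 (R : realType) (H : lmodType R[i]) (f : hermitian_form H)
    (W : {linear H -> H}) (S : lsubspace H)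
    (w11 : {linear S -> S}) (w12 : {linear orthocompl f S -> S})
    (w12' : {linear S -> orthocompl f S}) (w22 : {linear orthocompl f S -> orthocompl f S})
    (K : lsubspace S) (fK : hermitian_form K) (d : {linear K -> S})
    (f_krein : krein_space f)
    (W_bounded : krein_bounded f f W)
    (W_selfadjoint : adjoint_pair f f W W)
    (S_regular : regular_subspace f S)
    (W_block : block_form W w11 w12 w12' w22)
    (w12_adjoint :
      adjoint_pair (restr f (orthocompl f S)) (restr f S) w12 w12')
    (d_polar : polar_factorization (restr f S) w11 fK d) :
  (weakly_complementable f S W <-> range w12 `<=` range d) /\
  (weakly_complementable f S W ->
   exists (y : {linear orthocompl f S -> K}) (y' : {linear K -> orthocompl f S}),
     [/\ krein_bounded (restr f (orthocompl f S)) fK y,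
         forall t, w12 t = d (y t),
         forall x : orthocompl f S -> K, (forall t, w12 t = d (x t)) -> x =1 y,
         adjoint_pair (restr f (orthocompl f S)) fK y y'
       & forall X : {linear H -> H},
           schur_complement f S W X <->
           block_form (S := S) (T := orthocompl f S) X
             (fun=> 0) (fun=> 0) (fun=> 0) (fun t => w22 t - y' (y t))]).
Proof.
have [J0 [U [A [Q [pd sq KE fKE dE]]]]] := d_polar.
have [[J1 _] _] := S_regular.
have [J2 [h [sJ2 J2S]]] := signature_extension (signature_is J1)
  (regular_closed (J := J1) S_regular) (signature_is J0).
have [J [JE _]] := signature_of sJ2.
have JS (s : S) : J (val s) = val (J0 s) by rewrite JE J2S.
have Scl := regular_closed (J := J) S_regular.
have fwd := weakly_complementable_range W_selfadjoint W_block pd sq KE dE S_regular.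
split.
  split; first exact: fwd.
  exact: (range_weakly_complementable W_block pd sq dE JS).
move=> /fwd wd.
have [y [yE y_bnd]] := solution_exists w12_adjoint sq KE dE JS wd.
have [y' yy'] := solution_adjoint W_selfadjoint W_block pd sq KE fKE JS y_bnd.
exists y, y'; split=> //.
(* [krein_bounded] asks for packed signatures; those of the complement and of [K] induce exactly the
   norms in which [y] is already bounded. *)
- have [J3 J3E] := adapted_T JS.
  have [JT [_ eT]] := signature_of (T_signature J3E).
  have [K1 sK] := K_signature W_selfadjoint W_block pd sq KE fKE.
  have [JK [_ eK]] := signature_of sK.
  exists JT, JK; apply/bounded_opP; move: eT eK; rewrite /reverse_coercion => -> ->.
  exact: y_bnd.
- by move=> x xE t; apply: (d_injective sq KE dE); rewrite -xE yE.
- move=> X; split.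
    exact: (schur_complement_block W_selfadjoint W_block pd sq KE fKE dE JS Scl yE yy' S_regular).
  exact: (block_schur_complement W_selfadjoint W_block pd sq KE fKE dE JS yE y_bnd yy').
Qed.
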